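(* Let $(X_t)_{t\in[0,1]}$ be a centered continuous additive process, represented as $X_t=B_{V(t)}$, with $V$ strictly increasing, and let $T=V^{-1}$. Let $J$ be a nondegenerate closed subinterval of $[0,1]$. Suppose that for some $\gamma>0$ there is a constant $C>0$ with $$|T(x)-T(y)|\le C|x-y|^{\gamma}\quad\text{for all }x,y\in V(J).$$ Then, almost surely, $$\dim_F\mathcal{G}(X,J)\ge\frac{2\gamma}{2+\gamma}.$$
   Context: A real-valued process $(X_t)_{t\in[0,1]}$ is an additive process if it has independent increments, $X_0=0$ almost surely, and it is continuous in probability. It is a continuous additive process if moreover its sample paths are almost surely continuous, and it is centered if $\mathbb{E}[X_t]=0$ for all $t$. A centered continuous additive process can be represented as $X_t=B_{V(t)}$, where $B$ is a standard Brownian motion with $B_0=0$ and $V(t)=\mathbb{E}[X_t^2]$ is a continuous nondecreasing function with $V(0)=0$. The graph is $\mathcal{G}(X,E)=\{(t,X_t):t\in E\}\subset\mathbb{R}^2$. Fourier dimension: for a Borel set $E\subset\mathbb{R}^2$, $\dim_F E$ is the supremum of all $\alpha\ge0$ for which there is a nonzero finite Borel measure $\mu$ supported on $E$ and a constant $C$ with $|\widehat\mu(\xi)|\le C|\xi|^{-\alpha/2}$ for all $\xi\ne0$, where $\widehat\mu(\xi)=\int e^{-2\pi i\xi\cdot x}\,d\mu(x)$. *)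

(* Defs.v *)
From HB Require Import structures.
From mathcomp Require Import all_boot all_order all_algebra.
From mathcomp Require Import all_classical all_reals all_analysis.
From mathcomp Require Import complex.

Set Implicit Arguments.
Unset Strict Implicit.
Unset Printing Implicit Defensive.

Import Order.TTheory GRing.Theory Num.Theory.
Import numFieldNormedType.Exports.

Local Open Scope classical_set_scope.
Local Open Scope ring_scope.

Section processes.
Context (d : measure_display) (Omega : measurableType d) (R : realType)
  (P : probability Omega R).

(* Taking some [A i := setT] gives the product rule for subfamilies. *)
Definition mutually_independent (n : nat) (Y : 'I_n -> Omega -> R) : Prop :=
  forall A : 'I_n -> set R, (forall i, measurable (A i)) ->
    P (\bigcap_(i in [set: 'I_n]) (Y i @^-1` A i)) =
    (\big[*%E/1%E]_(i < n) P (Y i @^-1` A i))%E.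

(* Processes on [0, h] are families indexed by all of [R]; only measurability is
   asked of the variables with index outside [0, h]. *)
Definition independent_increments (h : R) (X : R -> {RV P >-> R}) : Prop :=
  forall (n : nat) (t : nat -> R),
    (forall i, (i <= n)%N -> t i \in `[0, h]) ->
    (forall i, (i < n)%N -> t i < t i.+1) ->
    mutually_independent (fun i : 'I_n => X (t i.+1) \- X (t i)).

Definition continuous_in_probability (h : R) (X : R -> {RV P >-> R}) : Prop :=
  forall t : R, t \in `[0, h] -> forall eps : R, 0 < eps ->
    P [set w | eps < `|X s w - X t w|]
      @[s --> within [set` `[0, h]] (nbhs t)] --> 0%E.

Definition continuous_paths (h : R) (X : R -> {RV P >-> R}) : Prop :=
  {ae P, forall w, {within [set` `[0, h]], continuous (fun t => X t w)}}.

Definition additive_process (X : R -> {RV P >-> R}) : Prop :=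
  [/\ independent_increments 1 X,
      {ae P, forall w, X 0 w = 0} &
      continuous_in_probability 1 X].

Definition centered_continuous_additive_process (X : R -> {RV P >-> R}) :
    Prop :=
  [/\ additive_process X,
      continuous_paths 1 X &
      forall t : R, t \in `[0, 1] -> ('E_P[X t] = 0)%E].

(* Standard Brownian motion with time horizon h. The second parameter of
   [normal_prob] is the standard deviation. *)
Definition standard_brownian_motion (h : R) (B : R -> {RV P >-> R}) : Prop :=
  [/\ {ae P, forall w, B 0 w = 0},
      independent_increments h B,
      forall s t : R, s \in `[0, h] -> t \in `[0, h] -> s < t ->
        forall A : set R, measurable A ->
          P ((B t \- B s) @^-1` A) = normal_prob 0 (Num.sqrt (t - s)) A &
      continuous_paths h B].

(* The Brownian motion is only required on [0, V 1], the range of [V]: a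
   Brownian motion with longer horizon would restrict [Omega]. *)
Definition brownian_representation (X B : R -> {RV P >-> R}) (V : R -> R) :
    Prop :=
  [/\ [/\ V 0 = 0,
          {in `[0, 1] &, {homo V : s t / s <= t}} &
          {within [set` `[0, 1]], continuous V}],
      forall t : R, t \in `[0, 1] ->
        ('E_P[fun w => (X t w ^+ 2)%R] = (V t)%:E)%E,
      standard_brownian_motion (V 1) B &
      forall t : R, t \in `[0, 1] -> {ae P, forall w, X t w = B (V t) w}].

End processes.

Section fourier_dimension.
Context (R : realType).
Implicit Types (mu : {finite_measure set (R * R)%type -> \bar R}) (xi x : R * R).

Definition graph_on (f : R -> R) (E : set R) : set (R * R)%type :=
  [set (t, f t) | t in E].

Definition dot x y : R := x.1 * y.1 + x.2 * y.2.

(* The library norm on [R * R] is the sup norm. *)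
Definition euclidean_norm x : R := Num.sqrt (dot x x).

Definition expi (theta : R) : R[i] := Complex (cos theta) (sin theta).

Definition complex_integral mu (f : R * R -> R[i]) : R[i] :=
  Complex (\int[mu]_x complex.Re (f x)) (\int[mu]_x complex.Im (f x)).

Definition fourier_transform mu xi : R[i] :=
  complex_integral mu (fun x => expi (- (2 * pi * dot xi x))).

(* For Borel [E], negligibility of the complement means [mu (~` E) = 0]. *)
Definition fourier_decay_on (E : set (R * R)%type) (alpha : R) : Prop :=
  exists mu : {finite_measure set (R * R)%type -> \bar R},
    [/\ mu setT != 0%E,
        mu.-negligible (~` E) &
        exists C : R, forall xi, xi != 0 ->
          Normc.normc (fourier_transform mu xi)
            <= C * euclidean_norm xi `^ (- (alpha / 2))].

Definition fourier_dim (E : set (R * R)%type) : \bar R :=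
  ereal_sup [set alpha%:E | alpha in
    [set alpha : R | 0 <= alpha /\ fourier_decay_on E alpha]].

End fourier_dimension.

(* Main.v *)
Require Import Defs.
From HB Require Import structures.
From mathcomp Require Import all_boot all_order all_algebra.
From mathcomp Require Import all_classical all_reals all_analysis.
From mathcomp Require Import complex ring lra zify measurable_realfun.

Set Implicit Arguments.
Unset Strict Implicit.
Unset Printing Implicit Defensive.

Import Order.TTheory GRing.Theory Num.Theory.
Import numFieldNormedType.Exports.

Local Open Scope classical_set_scope.
Local Open Scope ring_scope.

(** The measure that witnesses the bound is the image of Lebesgue measure on
    [[a, b]] under [t |-> (t, X_t)]. Up to a factor [2 pi] in the frequency,
    its Fourier transform is the limit of the Riemann sums
    [(b - a)/n * Z_n] with [Z_n = sum_(j < n) exp(i (x t_j + y X_(t_j)))],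
    so the matter is to bound [Z_n] with high probability, uniformly in [n].

    Second moments. The increments are independent, symmetric and Gaussian, so
    [chi = E exp(i y (X_t - X_s))] lies in [[0, 1]] and is multiplicative over
    adjacent intervals. The conditional expectation of a tail of [Z_n], divided
    by its first term, is therefore a deterministic number
    [g_k = 1 + exp(i b) chi_k g_(k-1)], where [b] is the increment of [x t]
    over one step. It is small for two reasons.
    If [|x|] is large, then [(1 - exp(i b)) g_k = 1 - w_k] with [|w_k| <= 1]
    ([mean_sum_oscillation]): this is summation by parts for coefficients that
    decrease, and it gives [|g_k| <= C n / |x|].
    If [|y|] is large, then [chi <= C / (y^2 (V t - V s))], and Hoelder
    continuity of the inverse [T] bounds [V t - V s] from below by
    [((t - s)/C)^(1/gamma)]; terms with [t - s] below a cutoff are bounded by 1.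
    With the best cutoff, [|g_k| <= C n |y|^(-2 gamma/(1 + gamma))].
    Since [gamma <= 1] ([holder_exponent_le1]), both cases give
    [|g_k| <= n K] with [K] of order [|(x, y)|^(- 2 gamma/(1 + gamma))].

    Exponential moments. The martingale that [Z_n] defines has increments
    bounded by [2 n K], and its conditional variances are deterministic with
    a telescoping sum, at most [2 n^2 K] ([cond_var_le]). A one-step
    estimate of Freedman type ([exp_moment_step]), integrated over the
    independent increments ([phase_sum_moment]), bounds the moment generating
    function of [Re (exp(i alpha) Z_n)] at [1/(4 n sqrt K)] by an absolute
    constant. Hence [P(|Z_n| >= s n) <= C exp(- s/(4 sqrt K))]
    ([large_sum_tail]).

    Conclusion. For the threshold [s = |(x, y)|^(- gamma/(2 + gamma))] the
    exponent [s / sqrt K] is a positive power of the frequency, because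
    [gamma/(2 + gamma) < gamma/(1 + gamma)]. The tail beats the polynomial
    number of points of a grid of mesh [1/N] at frequencies of size [N], and
    Borel-Cantelli applies along [N = 2^k] ([ae_rarely_large]). The sums are
    Lipschitz in the frequency, since paths are bounded, and this extends the
    bound from the grid to all frequencies ([path_integral_bound]). The
    exponent [2 gamma/(2 + gamma)] is thus itself admissible in the definition
    of the Fourier dimension. *)

(** * Independence *)

Section finite_pushforward.
Context d d' (T : measurableType d) (T' : measurableType d') (R : realType).
Variables (mu : {finite_measure set T -> \bar R}) (f : {mfun T >-> T'}).

Definition fpushforward : set T' -> \bar R := pushforward mu f.

Let fpushforward0 : fpushforward set0 = 0%E.
Proof. exact: measure0. Qed.

Let fpushforward_ge0 A : (0 <= fpushforward A)%E.
Proof. exact: measure_ge0. Qed.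

Let fpushforward_sigma_additive : semi_sigma_additive fpushforward.
Proof. exact: measure_semi_sigma_additive. Qed.

HB.instance Definition _ := isMeasure.Build _ _ _ fpushforward
  fpushforward0 fpushforward_ge0 fpushforward_sigma_additive.

Let fpushforward_fin : fin_num_fun fpushforward.
Proof.
move=> A mA; apply: fin_num_measure.
by rewrite -[_ @^-1` _]setTI; exact: measurable_funP.
Qed.

HB.instance Definition _ :=
  Measure_isFinite.Build _ _ _ fpushforward fpushforward_fin.

End finite_pushforward.

Section independence.
Context d (Omega : measurableType d) (R : realType) (P : probability Omega R).

Definition indep_pair d1 d2 (T1 : measurableType d1) (T2 : measurableType d2)
    (S : Omega -> T1) (Y : Omega -> T2) : Prop :=
  forall A B, measurable A -> measurable B ->
    P (S @^-1` A `&` Y @^-1` B) = (P (S @^-1` A) * P (Y @^-1` B))%E.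

Definition mfun_pair d1 d2 (T1 : measurableType d1) (T2 : measurableType d2)
    (S : {mfun Omega >-> T1}) (Y : {mfun Omega >-> T2}) :
    {mfun Omega >-> (T1 * T2)%type} :=
  HB.pack (fun w => (S w, Y w)) (isMeasurableFun.Build _ _ _ _ _
    (measurable_fun_pair (measurable_funPT S) (measurable_funPT Y))).

Lemma indep_integral d1 d2 (T1 : measurableType d1) (T2 : measurableType d2)
    (S : {mfun Omega >-> T1}) (Y : {mfun Omega >-> T2})
    (h : T1 * T2 -> \bar R) :
  indep_pair S Y -> measurable_fun [set: T1 * T2] h -> (forall z, 0 <= h z)%E ->
  (\int[P]_w h (S w, Y w) = \int[P]_w \int[P]_v h (S w, Y v))%E.
Proof.
move=> SY mh h0.
transitivity (\int[distribution P (mfun_pair S Y)]_z h z)%E.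
  by rewrite ge0_integral_distribution.
transitivity (\int[(distribution P S \x distribution P Y)%E]_z h z)%E.
  apply: eq_measure_integral => C mC _.
  by apply/esym/product_measure_unique => // A B mA mB; exact: SY.
rewrite fubini_tonelli1// ge0_integral_distribution//; first last.
- by move=> x; exact: integral_ge0.
- exact: measurable_fun_fubini_tonelli_F.
apply: eq_integral => w _ /=; rewrite /fubini_F ge0_integral_distribution//.
exact: measurableT_comp.
Qed.

(** The two sides are finite measures of [C] that agree on rectangles,
    where both are a product of three probabilities. *)
Lemma indep_pair_event d1 d2 (T1 : measurableType d1) (T2 : measurableType d2)
    (S : {mfun Omega >-> T1}) (Y : {mfun Omega >-> T2}) (E : set Omega) :
  measurable E -> indep_pair S Y ->
  (forall A B, measurable A -> measurable B ->
    P ((S @^-1` A `&` Y @^-1` B) `&` E) =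
    (P (S @^-1` A) * P (Y @^-1` B) * P E)%E) ->
  (forall A, measurable A -> P (S @^-1` A `&` E) = (P (S @^-1` A) * P E)%E) ->
  forall C, measurable C ->
    P ((fun w => (S w, Y w)) @^-1` C `&` E) =
    (P ((fun w => (S w, Y w)) @^-1` C) * P E)%E.
Proof.
move=> mE SY SYE SE C mC.
have PEfin : (P E < +oo)%E by rewrite ltey_eq fin_num_measure.
pose m1 := fpushforward (mfrestr mE PEfin) S.
have p0 : 0 <= fine (P E) by rewrite fine_ge0.
pose m' := mscale (NngNum p0) (distribution P (mfun_pair S Y)).
have e1 : (m1 \x distribution P Y)%E C =
    pushforward (mfrestr mE PEfin) (mfun_pair S Y) C.
  apply: product_measure_unique => // A B mA mB.
  rewrite -[LHS]/(P ((S @^-1` A `&` Y @^-1` B) `&` E)).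
  rewrite -[RHS]/(P (S @^-1` A `&` E) * P (Y @^-1` B))%E.
  by rewrite SYE// SE// muleAC.
have e2 : (m1 \x distribution P Y)%E C = m' C.
  apply: product_measure_unique => // A B mA mB.
  rewrite -[LHS]/((fine (P E))%:E * P (S @^-1` A `&` Y @^-1` B))%E.
  rewrite -[RHS]/(P (S @^-1` A `&` E) * P (Y @^-1` B))%E.
  by rewrite fineK ?fin_num_measure// SY// SE// muleA (muleC (P E)).
rewrite e1 in e2.
rewrite -[LHS]/(pushforward (mfrestr mE PEfin) (mfun_pair S Y) C) e2.
by rewrite muleC -[in RHS](fineK (fin_num_measure P _ mE)).
Qed.

(** Mutual independence of [W_0, ..., W_(n-1)], for a sequence indexed by
    [nat]. *)
Definition product_rule (n : nat) (W : nat -> Omega -> R) : Prop :=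
  forall A : nat -> set R, (forall i, measurable (A i)) ->
    P (\big[setI/setT]_(0 <= i < n) (W i @^-1` A i)) =
    (\big[*%E/1%E]_(0 <= i < n) P (W i @^-1` A i))%E.

Section recursion.
Context dT (T : measurableType dT) (s0 : T) (f : nat -> T * R -> T).
Hypothesis mf : forall k, measurable_fun [set: T * R] (f k).
Variable W : nat -> {RV P >-> R}.

(** A state driven by the variables [W_k] one at a time. The past enters the
    estimates only through such a state, so that a single random variable
    stands for the sigma-algebra of the past. *)
Fixpoint rec_state (k : nat) : {mfun Omega >-> T} :=
  if k is k'.+1 then
    HB.pack (f k' \o mfun_pair (rec_state k') (W k'))
      (isMeasurableFun.Build _ _ _ _ _
        (measurableT_comp (mf k') (measurable_funPT _)))
  else cst s0.

(** The induction has to carry all the later variables along: the step from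
    [k] to [k + 1] upgrades independence of the state, [W_k] and the event
    [E] that describes the later variables from rectangles to all
    measurable sets in the product of the state space and the line. *)
Lemma rec_state_indep_tail n k : product_rule n W -> (k <= n)%N ->
  forall (A : set T) (B : nat -> set R), measurable A ->
    (forall i, measurable (B i)) ->
    P (rec_state k @^-1` A `&` \big[setI/setT]_(k <= i < n) (W i @^-1` B i)) =
    (P (rec_state k @^-1` A) *
      \big[*%E/1%E]_(k <= i < n) P (W i @^-1` B i))%E.
Proof.
move=> WP; elim: k => [_ A B mA mB|k IH kn A B mA mB].
  rewrite /= preimage_cst; case: ifPn => _.
    by rewrite setTI probability_setT mul1e WP.
  by rewrite set0I measure0 mul0e.
have mW i X : measurable X -> measurable (W i @^-1` X).
  by move=> mX; rewrite -[_ @^-1` _]setTI; exact: measurable_funP.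
have mbig (B' : nat -> set R) : (forall i, measurable (B' i)) ->
    measurable (\big[setI/setT]_(k.+1 <= i < n) (W i @^-1` B' i)).
  move=> mB'; elim/big_ind : _ => //; last by move=> i _; exact: mW.
  exact: measurableI.
set E := \big[setI/setT]_(k.+1 <= i < n) _.
have PE : P E = (\big[*%E/1%E]_(k.+1 <= i < n) P (W i @^-1` B i))%E.
  have := IH (ltnW kn) setT (fun i => if i == k then setT else B i) measurableT.
  rewrite !preimage_setT setTI probability_setT mul1e.
  rewrite !(big_ltn kn) eqxx preimage_setT setTI.
  rewrite probability_setT mul1e.
  rewrite (_ : \big[setI/setT]_(k.+1 <= i < n) _ = E); last first.
    apply: eq_big_nat => i /andP[ki _]; rewrite gtn_eqF//.
  move=> ->; last by move=> i; case: ifP.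
  by apply: eq_big_nat => i /andP[ki _]; rewrite gtn_eqF.
have SYE A' B' : measurable A' -> measurable B' ->
    P ((rec_state k @^-1` A' `&` W k @^-1` B') `&` E) =
    (P (rec_state k @^-1` A') * P (W k @^-1` B') * P E)%E.
  move=> mA' mB'.
  have := IH (ltnW kn) A' (fun i => if i == k then B' else B i) mA'.
  rewrite !(big_ltn kn) eqxx.
  rewrite (_ : \big[setI/setT]_(k.+1 <= i < n) _ = E); last first.
    apply: eq_big_nat => i /andP[ki _]; rewrite gtn_eqF//.
  rewrite setIA => ->; last by move=> i; case: ifP.
  rewrite PE muleA; congr (_ * _)%E.
  by apply: eq_big_nat => i /andP[ki _]; rewrite gtn_eqF.
have SE A' : measurable A' ->
    P (rec_state k @^-1` A' `&` E) = (P (rec_state k @^-1` A') * P E)%E.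
  move=> mA'; have := SYE A' setT mA' measurableT.
  by rewrite preimage_setT setIT probability_setT mule1.
have SY : indep_pair (rec_state k) (W k).
  move=> A' B' mA' mB'.
  have := IH (ltnW kn) A' (fun i => if i == k then B' else setT) mA'.
  rewrite !(big_ltn kn) eqxx.
  rewrite big_nat big1 => [|i /andP[ki _]]; last by rewrite gtn_eqF// preimage_setT.
  rewrite big_nat big1 => [|i /andP[ki _]]; last first.
    by rewrite gtn_eqF// preimage_setT probability_setT.
  by rewrite setIT mule1; apply => i; case: ifP.
rewrite -PE.
have := @indep_pair_event _ _ _ _ (rec_state k) (W k) E (mbig _ mB) SY SYE SE
  (f k @^-1` A).
apply.
by rewrite -[_ @^-1` _]setTI; exact: mf.
Qed.

Lemma rec_state_indep n k : product_rule n W -> (k < n)%N ->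
  indep_pair (rec_state k) (W k).
Proof.
move=> WP kn A' B' mA' mB'.
have := @rec_state_indep_tail n k WP (ltnW kn) A'
  (fun i => if i == k then B' else setT) mA'.
rewrite !(big_ltn kn) eqxx.
rewrite big_nat big1 => [|i /andP[ki _]]; last by rewrite gtn_eqF// preimage_setT.
rewrite big_nat big1 => [|i /andP[ki _]]; last first.
  by rewrite gtn_eqF// preimage_setT probability_setT.
by rewrite setIT mule1; apply => i; case: ifP.
Qed.
End recursion.
End independence.

(** * Trigonometric moments of a random variable *)

Section trigonometric_moments.
Context d (Omega : measurableType d) (R : realType) (P : probability Omega R).

Lemma measurable_cos_comp d' (T : measurableType d') (f : T -> R) :
  measurable_fun setT f -> measurable_fun setT (fun t => cos (f t)).
Proof.
move=> mf; apply: (measurableT_comp _ mf); apply: continuous_measurable_fun.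
exact: continuous_cos.
Qed.

Lemma measurable_sin_comp d' (T : measurableType d') (f : T -> R) :
  measurable_fun setT f -> measurable_fun setT (fun t => sin (f t)).
Proof.
move=> mf; apply: (measurableT_comp _ mf); apply: continuous_measurable_fun.
exact: continuous_sin.
Qed.

Lemma measurable_scaled (y : R) (Y : {RV P >-> R}) :
  measurable_fun setT (fun w => y * Y w).
Proof. by apply: measurable_funM => //; exact: measurable_cst. Qed.

(** The real and imaginary parts of the characteristic function
    of [Y] at [y]. *)
Definition charcos (y : R) (Y : Omega -> R) : R := \int[P]_w cos (y * Y w).

Definition charsin (y : R) (Y : Omega -> R) : R := \int[P]_w sin (y * Y w).

Lemma integrable_bounded1 (f : Omega -> R) : measurable_fun setT f ->
  (forall w, `|f w| <= 1) -> P.-integrable setT (EFin \o f).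
Proof.
move=> mf fb; apply: measurable_bounded_integrable => //.
  by apply: (le_lt_trans (probability_le1 P measurableT)); exact: ltry.
exists 1; split; first by rewrite realE ler01.
by move=> z z1 w _ /=; apply: (le_trans (fb w)); exact: ltW.
Qed.

Lemma integrable_cosM y (Y : {RV P >-> R}) :
  P.-integrable setT (EFin \o (fun w => cos (y * Y w))).
Proof.
apply: integrable_bounded1 => [|w]; last exact: cos_max.
exact: measurable_cos_comp (measurable_scaled y Y).
Qed.

Lemma integrable_sinM y (Y : {RV P >-> R}) :
  P.-integrable setT (EFin \o (fun w => sin (y * Y w))).
Proof.
apply: integrable_bounded1 => [|w]; last exact: sin_max.
exact: measurable_sin_comp (measurable_scaled y Y).
Qed.

Lemma charcosE y (Y : {RV P >-> R}) :
  (\int[P]_w (cos (y * Y w))%:E = (charcos y Y)%:E)%E.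
Proof.
rewrite /charcos /Rintegral fineK//.
exact: (integrable_fin_num _ (integrable_cosM y Y)).
Qed.

Lemma charsinE y (Y : {RV P >-> R}) :
  (\int[P]_w (sin (y * Y w))%:E = (charsin y Y)%:E)%E.
Proof.
rewrite /charsin /Rintegral fineK//.
exact: (integrable_fin_num _ (integrable_sinM y Y)).
Qed.

Lemma charcos_le1 y (Y : {RV P >-> R}) : charcos y Y <= 1.
Proof.
rewrite -lee_fin -charcosE.
apply: (@le_trans _ _ (\int[P]_w (cst 1 w))%E); last first.
  by rewrite integral_cst// mul1e; exact: probability_le1.
apply: le_integral => //; first exact: integrable_cosM.
  exact: (finite_measure_integrable_cst _ 1).
by move=> w _; rewrite lee_fin; exact: cos_le1.
Qed.

Lemma integral_trig y (Y : {RV P >-> R}) (A B C : R) :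
  (\int[P]_w (A + B * cos (y * Y w) + C * sin (y * Y w))%:E =
    (A + B * charcos y Y + C * charsin y Y)%:E)%E.
Proof.
have ic := integrable_cosM y Y; have is_ := integrable_sinM y Y.
under eq_integral do rewrite !EFinD !EFinM.
rewrite integralD//=; first last.
- exact: integrableZl.
- apply: integrableD => //; first exact: (finite_measure_integrable_cst _ A).
  exact: integrableZl.
rewrite integralD//=; first last.
- exact: integrableZl.
- exact: (finite_measure_integrable_cst _ A).
rewrite integral_cst// !integralZl//= charcosE charsinE !EFinD !EFinM.
congr (_ + _ + _)%E; rewrite -[RHS]mule1; congr (_ * _)%E.
exact: probability_setT.
Qed.

Lemma integral_cos_affine y (Y : {RV P >-> R}) (A B : R) :
  (\int[P]_w (A + B * cos (y * Y w))%:E = (A + B * charcos y Y)%:E)%E.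
Proof.
have := integral_trig y Y A B 0; rewrite mul0r addr0 => <-.
by apply: eq_integral => w _; rewrite mul0r addr0.
Qed.

Lemma integral_sin_affine y (Y : {RV P >-> R}) (A C : R) :
  (\int[P]_w (A + C * sin (y * Y w))%:E = (A + C * charsin y Y)%:E)%E.
Proof.
have := integral_trig y Y A 0 C; rewrite mul0r addr0 => <-.
by apply: eq_integral => w _; rewrite mul0r addr0.
Qed.

Lemma integral_same_law (Y Z : {RV P >-> R}) (f : R -> \bar R) :
  (forall A : set R, measurable A -> P (Y @^-1` A) = P (Z @^-1` A)) ->
  measurable_fun setT f -> (forall x, 0 <= f x)%E ->
  (\int[P]_w f (Y w) = \int[P]_w f (Z w))%E.
Proof.
move=> YZ mf f0.
have := @ge0_integral_distribution _ _ _ _ _ P Y f mf f0.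
have := @ge0_integral_distribution _ _ _ _ _ P Z f mf f0.
rewrite /comp => <- <-.
by apply: eq_measure_integral => A mA _; exact: YZ.
Qed.

Lemma charcos_same_law y (Y Z : {RV P >-> R}) :
  (forall A : set R, measurable A -> P (Y @^-1` A) = P (Z @^-1` A)) ->
  charcos y Y = charcos y Z.
Proof.
move=> YZ.
(* Adding 1 makes the integrand nonnegative. *)
have := @integral_same_law Y Z (fun x => (1 + 1 * cos (y * x))%:E) YZ.
rewrite !integral_cos_affine !mul1r => h.
have : ((1 + charcos y Y)%:E = (1 + charcos y Z)%:E)%E.
  apply: h => [|x]; last by rewrite lee_fin mul1r -lerBlDl sub0r cos_geN1.
  apply/measurable_EFinP; apply: measurable_funD => //.
  apply: measurable_funM => //; apply: measurable_cos_comp.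
  exact: measurable_funM.
by move=> [] /addrI.
Qed.

Lemma charsin_symmetric y (Y : {RV P >-> R}) :
  (forall A : set R, measurable A ->
     P (Y @^-1` A) = P (Y @^-1` (-%R @^-1` A))) ->
  charsin y Y = 0.
Proof.
move=> sy.
have mN : measurable_fun setT (fun w => - Y w) by exact: measurableT_comp.
pose NY : {RV P >-> R} :=
  HB.pack (fun w => - Y w) (isMeasurableFun.Build _ _ _ _ _ mN).
have := @integral_same_law Y NY (fun x => (1 + 1 * sin (y * x))%:E) sy.
rewrite integral_sin_affine mul1r => h.
have eN : (\int[P]_w (1 + 1 * sin (y * NY w))%:E = (1 - charsin y Y)%:E)%E.
  rewrite -mulN1r -integral_sin_affine.
  by apply: eq_integral => w _; rewrite mul1r mulN1r mulrN sinN.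
rewrite eN in h.
have : ((1 + charsin y Y)%:E = (1 - charsin y Y)%:E)%E.
  apply: h => [|x]; last by rewrite lee_fin mul1r -lerBlDl sub0r sin_geN1.
  apply/measurable_EFinP; apply: measurable_funD => //.
  apply: measurable_funM => //; apply: measurable_sin_comp.
  exact: measurable_funM.
by move=> [] e; lra.
Qed.

Lemma charcosD y (Y Z : {RV P >-> R}) : indep_pair P Y Z ->
  charsin y Z = 0 -> charcos y (Y \+ Z) = charcos y Y * charcos y Z.
Proof.
move=> YZ hs.
pose h (z : R * R) : \bar R := (1 + 1 * cos (y * (z.1 + z.2)))%:E.
have mh : measurable_fun [set: R * R] h.
  apply/measurable_EFinP; apply: measurable_funD => //.
  apply: measurable_funM => //; apply: measurable_cos_comp.
  by apply: measurable_funM => //; exact: measurable_funD.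
have h0 z : (0 <= h z)%E by rewrite lee_fin mul1r -lerBlDl sub0r cos_geN1.
have := indep_integral YZ mh h0; rewrite /h /=.
rewrite (@integral_cos_affine y (Y \+ Z : {mfun _ >-> _})) mul1r.
have -> : (\int[P]_w \int[P]_v (1 + 1 * cos (y * (Y w + Z v)))%:E =
    \int[P]_w (1 + charcos y Z * cos (y * Y w))%:E)%E.
  apply: eq_integral => w _.
  transitivity (\int[P]_v (1 + cos (y * Y w) * cos (y * Z v)
      + (- sin (y * Y w)) * sin (y * Z v))%:E)%E.
    by apply: eq_integral => v _; rewrite mul1r mulrDr cosD mulNr addrA.
  by rewrite integral_trig hs mulr0 addr0 [in RHS]mulrC.
by rewrite integral_cos_affine => -[] /addrI ->; rewrite mulrC.
Qed.

End trigonometric_moments.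

(** * Exponential moments of sums of random phases *)

Section exponential_moment.
Context d (Omega : measurableType d) (R : realType) (P : probability Omega R).

Lemma ler_of_sqr (x G : R) : 0 <= G -> x ^+ 2 <= G ^+ 2 -> x <= G.
Proof.
move=> G0 xG; apply: (le_trans (ler_norm x)).
by rewrite -(@ler_pXn2r _ 2)// ?nnegrE// real_normK ?num_real.
Qed.

Lemma expR_le_quadratic (x : R) : x <= 1 / 2 -> expR x <= 1 + x + 2 * x ^+ 2.
Proof.
move=> x2; have := expR_ge1Dx (- x); rewrite expRN => h.
have e0 : 0 < expR x by exact: expR_gt0.
have h1 : (1 - x) * expR x <= 1.
  by rewrite -(ler_pM2r e0) mulVf ?gt_eqF// in h.
nra.
Qed.

(** With [z = p + i q] and [u = exp(i y Y)] this reads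
    [E exp(lam Re(z e^(i alpha) u))
       <= exp(lam Re(z e^(i alpha) E u) + 2 lam^2 |z|^2 (1 - |E u|^2))]:
    the fluctuation [Re(z e^(i alpha) (u - E u))] is centered, it is bounded
    because of the condition on [lam], and its square is at most
    [|z|^2 |u - E u|^2], which has mean [|z|^2 (1 - |E u|^2)]. *)
Lemma exp_moment_step (y lam G p q alpha : R) (Y : {RV P >-> R}) :
  charsin P y Y = 0 -> 0 <= charcos P y Y ->
  0 <= lam -> 0 <= G -> p ^+ 2 + q ^+ 2 <= G ^+ 2 -> 4 * lam * G <= 1 ->
  (\int[P]_w (expR (lam * (p * cos (alpha + y * Y w)
                           - q * sin (alpha + y * Y w))))%:E
   <= (expR (lam * charcos P y Y * (p * cos alpha - q * sin alpha)
        + 2 * lam ^+ 2 * ((p ^+ 2 + q ^+ 2) * (1 - charcos P y Y ^+ 2))))%:E)%E.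
Proof.
move=> hs chi0 lam0 G0 pqG lamG.
have chi1 := charcos_le1 y Y; set chi := charcos P y Y in chi0 chi1 *.
have amp (t : R) : `|p * cos t - q * sin t| <= G.
  rewrite -(@ler_pXn2r _ 2)// ?nnegrE// real_normK ?num_real//.
  apply: le_trans pqG.
  have := cos2Dsin2 t; set c := cos t; set s := sin t => cs.
  have -> : p ^+ 2 + q ^+ 2 = (p ^+ 2 + q ^+ 2) * (c ^+ 2 + s ^+ 2).
    by rewrite cs mulr1.
  have := sqr_ge0 (p * s + q * c); nra.
set La := p * cos alpha - q * sin alpha.
set Lb := p * sin alpha + q * cos alpha.
set V := p ^+ 2 + q ^+ 2.
have LL : La ^+ 2 + Lb ^+ 2 = V.
  rewrite /V -[RHS]mulr1 -(cos2Dsin2 alpha) /La /Lb; ring.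
(* The quadratic upper bound of the exponential, expanded in cos and sin. *)
pose A := 1 - lam * La * chi + 2 * lam ^+ 2 * V * (1 + chi ^+ 2).
pose B := lam * La - 4 * lam ^+ 2 * V * chi.
pose C := - (lam * Lb).
set E := expR (lam * chi * La).
have E0 : 0 <= E by exact: expR_ge0.
have myY := measurable_scaled y Y.
have maY : measurable_fun setT (fun w => alpha + y * Y w).
  by apply: measurable_funD => //; exact: measurable_cst.
apply: (@le_trans _ _ (\int[P]_w (E * A + E * B * cos (y * Y w)
                              + E * C * sin (y * Y w))%:E)%E).
  apply: ge0_le_integral => //.
  - apply/measurable_EFinP; apply: measurableT_comp => //.
    apply: measurable_funM => //.
    apply: measurable_funB; apply: measurable_funM => //.
    + exact: measurable_cos_comp.
    + exact: measurable_sin_comp.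
  - apply/measurable_EFinP; apply: measurable_funD.
      apply: measurable_funD => //; apply: measurable_funM => //.
      exact: measurable_cos_comp.
    by apply: measurable_funM => //; exact: measurable_sin_comp.
  - move=> w _; rewrite lee_fin cosD sinD.
    set c := cos (y * Y w); set s := sin (y * Y w).
    have cs : c ^+ 2 + s ^+ 2 = 1 by exact: cos2Dsin2.
    have -> : p * (cos alpha * c - sin alpha * s) -
         q * (sin alpha * c + cos alpha * s) = La * c - Lb * s.
      rewrite /La /Lb; ring.
    set D := La * (c - chi) - Lb * s.
    have -> : lam * (La * c - Lb * s) = lam * chi * La + lam * D.
      by rewrite /D; ring.
    rewrite expRD -/E.
    have D2G : D <= 2 * G.
      have h1 := amp (alpha + y * Y w); have h2 := amp alpha.
      have -> : D = (p * cos (alpha + y * Y w) - q * sin (alpha + y * Y w))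
          - chi * La.
        rewrite cosD sinD /D /La /Lb -/c -/s; ring.
      move: h1 h2; rewrite -/La !ler_norml => /andP[_ h1] /andP[h2 _].
      nra.
    have lD : lam * D <= 1 / 2 by nra.
    have := expR_le_quadratic lD.
    have D2 : D ^+ 2 <= V * (1 - 2 * chi * c + chi ^+ 2).
      rewrite -LL.
      have -> : (1 - 2 * chi * c + chi ^+ 2) = (c - chi) ^+ 2 + s ^+ 2.
        by rewrite -[X in X - _]cs; ring.
      rewrite /D; have := sqr_ge0 (La * s + Lb * (c - chi)); nra.
    move=> h.
    have -> : E * A + E * B * c + E * C * s = E * (A + B * c + C * s) by ring.
    apply: ler_wpM2l => //.
    apply: (le_trans h).
    have hl : 2 * (lam * D) ^+ 2 <=
        2 * lam ^+ 2 * (V * (1 - 2 * chi * c + chi ^+ 2)).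
      rewrite (_ : 2 * (lam * D) ^+ 2 = 2 * lam ^+ 2 * D ^+ 2); last by ring.
      by apply: ler_wpM2l => //; rewrite mulr_ge0// sqr_ge0.
    apply: (le_trans (lerD (lexx _) hl)).
    rewrite /A /B /C /D le_eqVlt; apply/orP; left; apply/eqP; ring.
rewrite integral_trig hs mulr0 addr0 -/chi lee_fin.
have -> : E * A + E * B * chi =
    E * (1 + 2 * lam ^+ 2 * (V * (1 - chi ^+ 2))).
  by rewrite /A /B; ring.
rewrite expRD -/E; apply: ler_wpM2l => //; exact: expR_ge1Dx.
Qed.

End exponential_moment.

(** * The expected phase sums *)

Section mean_sums.
Context (R : realType).

(** The mean value theorem, as [cos >= cos 1] on [[0, 1]]. *)
Lemma sin_lower (x : R) : `|x| <= 1 -> (cos 1 * x) ^+ 2 <= sin x ^+ 2.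
Proof.
have pos (t : R) : 0 < t -> t <= 1 -> cos 1 * t <= sin t.
  move=> t0 t1.
  have [|c] := @MVT R sin cos 0 t t0.
    by apply: continuous_subspaceT => z; exact: continuous_sin.
  rewrite in_itv/= => /andP[c0 ct]; rewrite sin0 !subr0 => ->.
  apply: ler_wpM2r; first exact: ltW.
  have pi2 := pi_ge2 R.
  by rewrite leNgt ltr_cos ?in_itv/= -?leNgt; [lra|apply/andP; split; lra..].
have c1 := @cos1_gt0 R.
move=> xle; have [x0|x0|->] := ltrgt0P x; last by rewrite mulr0 sin0.
- have := pos _ x0; rewrite (ger0_norm (ltW x0)) in xle => /(_ xle) h.
  by rewrite lerXn2r// nnegrE ?mulr_ge0 ?ltW//; apply: lt_le_trans h; rewrite mulr_gt0.
- have := pos (- x); rewrite (ltr0_norm x0) in xle; rewrite oppr_gt0 => /(_ x0 xle) h.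
  rewrite -(sqrrN (sin x)) -sinN -(sqrrN (cos 1 * x)) -mulrN.
  have x0' : 0 < - x by rewrite oppr_gt0.
  by rewrite lerXn2r// nnegrE ?mulr_ge0 ?ltW//; apply: lt_le_trans h; rewrite mulr_gt0.
Qed.

Variables (b : R) (chi : nat -> R).

(** The complex numbers [g_k] with [g_0 = 0] and
    [g_(k+1) = 1 + exp(i b) chi_k g_k], as pairs of real numbers: the means of
    the random sums [phase_sum] below when [chi_k] is the mean of the
    [k]-th phase factor. *)
Fixpoint mean_sum (k : nat) : R * R :=
  if k is k'.+1 then
    (1 + chi k' * (cos b * (mean_sum k').1 - sin b * (mean_sum k').2),
     chi k' * (sin b * (mean_sum k').1 + cos b * (mean_sum k').2))
  else (0, 0).

(** The sum of the conditional variances in the martingale decomposition of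
    [phase_sum]. It is deterministic, and this is what makes
    all exponential moments accessible at once. *)
Fixpoint cond_var (k : nat) : R :=
  if k is k'.+1 then
    cond_var k' +
      ((mean_sum k').1 ^+ 2 + (mean_sum k').2 ^+ 2) * (1 - chi k' ^+ 2)
  else 0.

Section variance.
Variables (n : nat) (G : R).
Hypothesis G0 : 0 <= G.
Hypothesis hG : forall k, (k <= n)%N ->
  (mean_sum k).1 ^+ 2 + (mean_sum k).2 ^+ 2 <= G ^+ 2.

(** The sum telescopes, because
    [|g_(k+1)|^2 = 2 Re g_(k+1) - 1 + chi_k^2 |g_k|^2]: up to boundary terms
    it is the sum of the [2 Re g_k - 1]. *)
Lemma cond_var_le k : (k <= n)%N -> cond_var k <= 2 * k%:R * G.
Proof.
move=> kn; suff : cond_var k + ((mean_sum k).1 ^+ 2 + (mean_sum k).2 ^+ 2)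
    <= 2 * k%:R * G.
  by apply: le_trans; rewrite lerDl addr_ge0// sqr_ge0.
elim: k kn => [_|k IH kn]; first by rewrite /= !expr0n/= !addr0 mulr0 mul0r.
have := IH (ltnW kn); have := hG kn.
have pG : (mean_sum k.+1).1 <= G.
  have := hG kn; set p := (mean_sum k.+1).1; set q := _.2 => h.
  apply: ler_of_sqr => //; apply: le_trans h; rewrite lerDl; exact: sqr_ge0.
move: pG => + _ {IH}.
rewrite /=; set p := (mean_sum k).1; set q := (mean_sum k).2.
set c := cos b; set s := sin b.
have cs : c ^+ 2 + s ^+ 2 = 1 by exact: cos2Dsin2.
set x := chi k => pG h.
have -> : cond_var k + (p ^+ 2 + q ^+ 2) * (1 - x ^+ 2)
   + ((1 + x * (c * p - s * q)) ^+ 2 + (x * (s * p + c * q)) ^+ 2)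
  = cond_var k + (p ^+ 2 + q ^+ 2) * (1 - x ^+ 2) + 1 + 2 * x * (c * p - s * q)
    + x ^+ 2 * (c ^+ 2 + s ^+ 2) * (p ^+ 2 + q ^+ 2) by ring.
rewrite cs -natr1; move: h pG; set k' := k%:R; lra.
Qed.

End variance.

Variable n : nat.
Hypothesis chi01 : forall k, (k < n)%N -> 0 <= chi k <= 1.
Notation p k := (mean_sum k).1.
Notation q k := (mean_sum k).2.

(** Write [(1 - z) g_k = 1 - w_k] with [z = exp(i b)]. Then [w_0 = 1] and
    [w_(k+1) = z (1 - chi_k + chi_k w_k)], so that [|w_k| <= 1] is preserved by
    convexity of the unit disc. The factor [2 - 2 cos b] is [|1 - z|^2]. *)
Lemma mean_sum_oscillation k : (k <= n)%N ->
  (2 - 2 * cos b) * (p k ^+ 2 + q k ^+ 2) <= 4.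
Proof.
have cs := cos2Dsin2 b.
suff H : (k <= n)%N -> (1 - ((1 - cos b) * p k + sin b * q k)) ^+ 2
   + ((1 - cos b) * q k - sin b * p k) ^+ 2 <= 1.
  move=> /H; move: (p k) (q k) cs => P Q; move: (cos b) (sin b) => c s cs.
  set u := (1 - c) * P + s * Q; set v := (1 - c) * Q - s * P => h.
  have -> : (2 - 2 * c) * (P ^+ 2 + Q ^+ 2) = u ^+ 2 + v ^+ 2.
    rewrite (_ : 2 - 2 * c = (1 - c) ^+ 2 + s ^+ 2); first by rewrite /u /v; ring.
    by rewrite (_ : s ^+ 2 = 1 - c ^+ 2); [ring|lra].
  have u1 : `|1 - u| <= 1.
    rewrite -(@ler_pXn2r _ 2)// ?nnegrE// real_normK ?num_real// expr1n.
    by apply: le_trans h; rewrite lerDl sqr_ge0.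
  by move: u1; rewrite ler_norml => /andP[u1 u2]; nra.
elim: k => [_|k IH kn]; first by rewrite /= !mulr0 !addr0 !subr0 expr1n expr0n/= addr0.
have := IH (ltnW kn); have /andP[x0 x1] := chi01 kn.
rewrite /=; move: (p k) (q k) (chi k) x0 x1 cs => P Q x x0 x1.
move: (cos b) (sin b) => c s cs.
set u := 1 - ((1 - c) * P + s * Q); set v := (1 - c) * Q - s * P => h.
set L := (X in X <= _).
have -> : L = (c ^+ 2 + s ^+ 2) * ((1 - x + x * u) ^+ 2 + (x * v) ^+ 2).
  rewrite /L /u /v.
  have -> : 1 - ((1 - c) * (1 + x * (c * P - s * Q)) + s * (x * (s * P + c * Q)))
    = c * (1 - x + x * (1 - ((1 - c) * P + s * Q))) + s * (x * ((1 - c) * Q - s * P))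
    by ring.
  have -> : (1 - c) * (x * (s * P + c * Q)) - s * (1 + x * (c * P - s * Q))
    = - (s * (1 - x + x * (1 - ((1 - c) * P + s * Q))) - c * (x * ((1 - c) * Q - s * P)))
    by ring.
  ring.
rewrite cs mul1r.
have u1 : u <= 1 by apply: ler_of_sqr => //; rewrite expr1n; apply: le_trans h;
  rewrite lerDl sqr_ge0.
have x2 : x ^+ 2 * (u ^+ 2 + v ^+ 2) <= x ^+ 2 by rewrite ler_piMr ?sqr_ge0.
have x3 : x * (1 - x) * u <= x * (1 - x) by rewrite ler_piMr// mulr_ge0// subr_ge0.
rewrite (_ : _ + _ = (1 - x) ^+ 2 + 2 * (x * (1 - x) * u) + x ^+ 2 * (u ^+ 2 + v ^+ 2));
  last by ring.
lra.
Qed.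

Lemma mean_sum_small_phase k : (k <= n)%N -> `|b| <= 1 ->
  (cos 1 * b) ^+ 2 * (p k ^+ 2 + q k ^+ 2) <= 4.
Proof.
move=> kn b1; apply: le_trans (mean_sum_oscillation kn).
apply: ler_wpM2r; first by rewrite addr_ge0 ?sqr_ge0.
apply: (le_trans (sin_lower b1)).
have := cos2Dsin2 b; have := cos_le1 b; have := sqr_ge0 (1 - cos b); nra.
Qed.

(** The triangle inequality bound of [mean_sum]. *)
Fixpoint abs_sum (k : nat) : R := if k is k'.+1 then 1 + chi k' * abs_sum k' else 0.

Lemma mean_sum_abs k : (k <= n)%N ->
  0 <= abs_sum k /\ p k ^+ 2 + q k ^+ 2 <= abs_sum k ^+ 2.
Proof.
elim: k => [_|k IH kn]; first by rewrite /= !expr0n/= addr0.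
have [s0 hs] := IH (ltnW kn); have /andP[x0 x1] := chi01 kn; rewrite /=.
have cs := cos2Dsin2 b.
move: (p k) (q k) (chi k) (abs_sum k) s0 hs x0 x1 => P Q x S s0 hs x0 x1.
split; first by rewrite addr_ge0// mulr_ge0.
move: (cos b) (sin b) cs => c s cs.
have amp : c * P - s * Q <= S.
  apply: ler_of_sqr => //; apply: le_trans hs.
  rewrite (_ : P ^+ 2 + Q ^+ 2 = (c ^+ 2 + s ^+ 2) * (P ^+ 2 + Q ^+ 2));
    last by rewrite cs mul1r.
  have := sqr_ge0 (c * Q + s * P); nra.
rewrite (_ : _ + _ = 1 + 2 * x * (c * P - s * Q)
  + x ^+ 2 * ((c ^+ 2 + s ^+ 2) * (P ^+ 2 + Q ^+ 2))); last by ring.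
rewrite cs mul1r (_ : (1 + x * S) ^+ 2 = 1 + 2 * x * S + x ^+ 2 * S ^+ 2); last by ring.
apply: lerD; last by apply: ler_wpM2l => //; exact: sqr_ge0.
by rewrite lerD2l; apply: ler_wpM2l => //; rewrite mulr_ge0.
Qed.

(** The indices run backwards: [chi_k] belongs to the step from
    [n - k - 1] to [n - k], so that [abs_sum k] collects the times from
    [n - k] on. *)
Lemma abs_sum_expand (D : nat -> nat -> R) : (forall i, D i i = 1) ->
  (forall i j l, (i <= j <= l)%N -> (l <= n)%N -> D i j * D j l = D i l) ->
  (forall k, (k < n)%N -> chi k = D (n - k.+1)%N (n - k)%N) ->
  forall k, (k <= n)%N -> abs_sum k = \sum_(0 <= i < k) D (n - k)%N (n - k + i)%N.
Proof.
move=> D1 DM Dchi; elim=> [_|k IH kn]; first by rewrite big_nil.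
rewrite big_nat_recl// addn0 D1 /= IH ?(ltnW kn)// Dchi// mulr_sumr.
congr (_ + _); apply: eq_big_nat => i /andP[_ ik].
rewrite addnS -addSn subnSK// DM//.
  by rewrite leq_addr andbT leq_sub2l.
by rewrite -[leqRHS](subnK (ltnW kn)) leq_add2l ltnW.
Qed.

Lemma sum_cutoff (f : nat -> R) (i0 k : nat) (eps : R) : 0 <= eps ->
  (forall i, (i < k)%N -> f i <= 1) ->
  (forall i, (i < k)%N -> (i0 <= i)%N -> f i <= eps) ->
  \sum_(0 <= i < k) f i <= i0%:R + k%:R * eps.
Proof.
move=> e0 f1 fe.
have : \sum_(0 <= i < k) f i <= \sum_(0 <= i < k) ((i < i0)%N%:R + eps).
  apply: ler_sum_nat => i /andP[_ ik]; case: ltnP => h;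
    first by apply: (le_trans (f1 _ ik)); rewrite lerDl.
  by rewrite add0r fe.
move/le_trans; apply; rewrite big_split/= sumr_const_nat subn0 mulr_natl lerD2r.
have -> : \sum_(0 <= i < k) ((i < i0)%N%:R : R) = (minn k i0)%:R.
  elim: k {f1 fe} => [|k IH]; first by rewrite big_nil min0n.
  by rewrite big_nat_recr//= IH -natrD; congr (_%:R); lia.
by rewrite ler_nat geq_minr.
Qed.

End mean_sums.

(** * Exponential tails of the phase sums *)

Section phase_sum.
Context d (Omega : measurableType d) (R : realType) (P : probability Omega R).

Lemma measurable_rotation d' (T : measurableType d') (theta f g : T -> R) :
  measurable_fun setT theta -> measurable_fun setT f -> measurable_fun setT g ->
  measurable_fun setT (fun t => cos (theta t) * f t - sin (theta t) * g t).
Proof.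
move=> mt mf mg; apply: measurable_funB; apply: measurable_funM => //.
  exact: measurable_cos_comp.
exact: measurable_sin_comp.
Qed.

Variables (b y : R) (W : nat -> {RV P >-> R}).

(** Multiplication of [z.1], seen as a complex number, by
    [exp(i (b + y z.2))], followed by the addition of 1. *)
Definition rot_step (z : (R * R) * R) : R * R :=
  (1 + (cos (b + y * z.2) * z.1.1 - sin (b + y * z.2) * z.1.2),
   sin (b + y * z.2) * z.1.1 + cos (b + y * z.2) * z.1.2).

Lemma measurable_rot_step : measurable_fun [set: (R * R) * R] rot_step.
Proof.
have m2 : measurable_fun setT (fun z : (R * R) * R => b + y * z.2).
  by apply: measurable_funD => //; apply: measurable_funM.
have m11 : measurable_fun setT (fun z : (R * R) * R => z.1.1).
  exact: (measurableT_comp measurable_fst measurable_fst).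
have m12 : measurable_fun setT (fun z : (R * R) * R => z.1.2).
  exact: (measurableT_comp measurable_snd measurable_fst).
apply: measurable_fun_pair.
  by apply: measurable_funD => //; exact: measurable_rotation.
apply: measurable_funD; apply: measurable_funM => //.
  exact: measurable_sin_comp.
exact: measurable_cos_comp.
Qed.

(** The random sums [Z_0 = 0], [Z_(k+1) = 1 + exp(i (b + y W_k)) Z_k]. Each new
    variable rotates the whole sum accumulated so far, so that [Z_k] depends
    on [W_0, ..., W_(k-1)] through one pair of real numbers. *)
Definition phase_sum (k : nat) : {mfun Omega >-> (R * R)%type} :=
  @rec_state _ _ _ P _ (R * R)%type (0, 0) _ (fun=> measurable_rot_step) W k.

Let chi k := charcos P y (W k).

Variables (n : nat) (G : R).
Hypothesis G0 : 0 <= G.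
Hypothesis hG : forall k, (k <= n)%N ->
  (mean_sum b chi k).1 ^+ 2 + (mean_sum b chi k).2 ^+ 2 <= G ^+ 2.
Hypothesis WP : product_rule P n (fun k => W k : Omega -> R).
Hypothesis chi0 : forall k, (k < n)%N -> 0 <= chi k.
Hypothesis hs : forall k, (k < n)%N -> charsin P y (W k) = 0.

(** Induction on [k], for all [alpha] at once. By independence the integral over
    [Z_k] can be taken first with [W_k] fixed; the induction hypothesis at the
    angle [alpha + b + y W_k] bounds it, and [exp_moment_step] integrates that
    bound over [W_k]. *)
Lemma phase_sum_moment k (lam alpha : R) : (k <= n)%N -> 0 <= lam ->
  4 * lam * G <= 1 ->
  (\int[P]_w (expR (lam * (cos alpha * (phase_sum k w).1
                           - sin alpha * (phase_sum k w).2)))%:E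
   <= (expR (lam * (cos alpha * (mean_sum b chi k).1
                    - sin alpha * (mean_sum b chi k).2)
        + 2 * lam ^+ 2 * cond_var b chi k))%:E)%E.
Proof.
move=> + lam0 lamG; elim: k alpha => [|k IH] alpha kn.
  rewrite /= !mulr0 subr0 !mulr0 addr0 expR0 integral_cst// mul1e.
  exact: probability_le1.
have YS : indep_pair P (W k) (phase_sum k).
  move=> A B mA mB; rewrite setIC muleC.
  exact: (@rec_state_indep _ _ _ P _ (R * R)%type (0, 0) _
    (fun=> measurable_rot_step) _ _ _ WP kn).
pose h (z : R * (R * R)) : \bar R := (expR (lam * (cos alpha +
  (cos (alpha + b + y * z.1) * z.2.1 - sin (alpha + b + y * z.1) * z.2.2))))%:E.
have mh : measurable_fun [set: R * (R * R)] h.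
  apply/measurable_EFinP; apply: measurableT_comp => //.
  apply: measurable_funM => //; apply: measurable_funD => //.
  apply: measurable_rotation.
  - by apply: measurable_funD => //; apply: measurable_funM.
  - exact: (measurableT_comp measurable_fst measurable_snd).
  - exact: (measurableT_comp measurable_snd measurable_snd).
rewrite (_ : (\int[P]_w _)%E = (\int[P]_w h (W k w, phase_sum k w))%E); last first.
  apply: eq_integral => w _; rewrite /h /phase_sum /=.
  rewrite -addrA; congr (expR (lam * _))%:E.
  rewrite (cosD alpha) (sinD alpha).
  set c := cos (b + _); set s := sin (b + _); ring.
rewrite indep_integral//; last by move=> z; rewrite lee_fin expR_ge0.
pose p := (mean_sum b chi k).1; pose q := (mean_sum b chi k).2.
have mY : measurable_fun setT (fun w => alpha + b + y * W k w).
  by apply: measurable_funD => //; exact: measurable_scaled.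
have mexp : measurable_fun [set: Omega] (fun w =>
    (expR (lam * (p * cos (alpha + b + y * W k w)
                  - q * sin (alpha + b + y * W k w))))%:E).
  apply/measurable_EFinP; apply: measurableT_comp => //.
  apply: measurable_funM => //.
  apply: measurable_funB; apply: measurable_funM => //.
    exact: measurable_cos_comp.
  exact: measurable_sin_comp.
pose K : R := expR (lam * cos alpha + 2 * lam ^+ 2 * cond_var b chi k).
pose F (w : Omega) := (K%:E *
  (expR (lam * (p * cos (alpha + b + y * W k w)
                  - q * sin (alpha + b + y * W k w))))%:E)%E.
apply: (@le_trans _ _ (\int[P]_w F w)%E).
  apply: ge0_le_integral => //.
  - by move=> w _; apply: integral_ge0 => v _; rewrite lee_fin expR_ge0.
  - have mhS : measurable_fun [set: R * Omega]
        (fun z : R * Omega => h (z.1, phase_sum k z.2)).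
      apply: (measurableT_comp mh); apply: measurable_fun_pair => //.
      exact: (measurableT_comp (measurable_funPT _) measurable_snd).
    have mJ := @measurable_fun_fubini_tonelli_F _ _ _ _ _ P _ mhS
      (fun z => expR_ge0 _).
    exact: (measurableT_comp mJ (measurable_funPT (W k))).
  - by apply: measurable_funeM.
  - move=> w _; rewrite /F /h /=.
    have IHk := IH (alpha + b + y * W k w) (ltnW kn).
    pose f v := (expR (lam *
        (cos (alpha + b + y * W k w) * (phase_sum k v).1
         - sin (alpha + b + y * W k w) * (phase_sum k v).2)))%:E.
    have mf : measurable_fun [set: Omega] f.
      apply/measurable_EFinP; apply: measurableT_comp => //.
      apply: measurable_funM => //; apply: measurable_rotation => //.
        exact: (measurableT_comp measurable_fst (measurable_funPT _)).
      exact: (measurableT_comp measurable_snd (measurable_funPT _)).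
    rewrite (_ : (\int[P]_v _)%E =
        ((expR (lam * cos alpha))%:E * \int[P]_v f v)%E); last first.
      have f0 v : (0 <= f v)%E by rewrite lee_fin expR_ge0.
      have e0 : (0 <= (expR (lam * cos alpha))%:E)%E by rewrite lee_fin expR_ge0.
      rewrite -(ge0_integralZl P measurableT mf (fun v _ => f0 v) e0).
      apply: eq_integral => v _; rewrite /f -EFinM -expRD.
      congr (expR _)%:E; exact: mulrDr.
    apply: (le_trans (lee_wpmul2l _ IHk)); first by rewrite lee_fin expR_ge0.
    rewrite -!EFinM -!expRD lee_fin ler_expR -/p -/q.
    rewrite le_eqVlt; apply/orP; left; apply/eqP; ring.
have K0 : (0 <= K%:E)%E by rewrite lee_fin expR_ge0.
rewrite /F ge0_integralZl//.
have := @exp_moment_step _ _ _ P y lam G p q (alpha + b) (W k)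
  (hs kn) (chi0 kn) lam0 G0 (hG (ltnW kn)) lamG.
move=> /(lee_wpmul2l K0)/le_trans; apply.
rewrite -EFinM -expRD lee_fin ler_expR /= -/p -/q cosD sinD -/(chi k).
rewrite le_eqVlt; apply/orP; left; apply/eqP; ring.
Qed.

Lemma phase_sum_tail (lam alpha t : R) : 0 < lam -> 4 * lam * G <= 1 ->
  (P [set w | (t <= cos alpha * (phase_sum n w).1
                    - sin alpha * (phase_sum n w).2)%R]
   <= (expR (lam * G + 4 * lam ^+ 2 * n%:R * G - lam * t))%:E)%E.
Proof.
move=> lam0 lamG.
pose Z w := cos alpha * (phase_sum n w).1 - sin alpha * (phase_sum n w).2.
have mZ : measurable_fun setT Z.
  apply: (@measurable_rotation _ _ (cst alpha)) => //.
    exact: (measurableT_comp measurable_fst (measurable_funPT _)).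
  exact: (measurableT_comp measurable_snd (measurable_funPT _)).
pose X : {RV P >-> R} := HB.pack Z (isMeasurableFun.Build _ _ _ _ _ mZ).
apply: (le_trans (chernoff X t lam0)).
rewrite expRD EFinM; apply: lee_wpmul2r; first by rewrite lee_fin expR_ge0.
rewrite /mmt_gen_fun unlock /=.
under eq_integral do rewrite mulrC.
apply: (le_trans (phase_sum_moment _ (leqnn n) (ltW lam0) lamG)).
rewrite lee_fin ler_expR; apply: lerD.
  apply: ler_wpM2l; first exact: ltW.
  have := hG (leqnn n); set p := _.1; set q := _.2 => h.
  have := cos2Dsin2 alpha; set c := cos alpha; set s := sin alpha => cs.
  apply: ler_of_sqr => //; apply: le_trans h.
  have -> : p ^+ 2 + q ^+ 2 = (p ^+ 2 + q ^+ 2) * (c ^+ 2 + s ^+ 2).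
    by rewrite cs mulr1.
  have := sqr_ge0 (p * s + q * c); nra.
have h := cond_var_le G0 hG (leqnn n).
have : 2 * lam ^+ 2 * cond_var b chi n <= 2 * lam ^+ 2 * (2 * n%:R * G).
  by apply: ler_wpM2l => //; rewrite mulr_ge0// sqr_ge0.
by move/le_trans; apply; rewrite le_eqVlt; apply/orP; left; apply/eqP; ring.
Qed.

End phase_sum.

(** * Gaussian increments *)

Section normal_facts.
Context (R : realType).
Notation mu := (@lebesgue_measure R).

Lemma normal_prob_opp (sigma : R) (A : set R) : sigma != 0 -> measurable A ->
  normal_prob 0 sigma (-%R @^-1` A) = normal_prob 0 sigma A.
Proof.
move=> s0 mA; rewrite /normal_prob.
rewrite -[RHS](@eq_measure_integral _ _ _ _ _
  (pushforward mu (-%R : R -> measurableTypeR R))); last first.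
  by move=> B mB _; exact: lebesgue_measureN.
rewrite ge0_integral_pushforward //; first last.
- by move=> x _; rewrite lee_fin normal_pdf_ge0.
- apply/measurable_EFinP; apply: measurable_funTS; exact: measurable_normal_pdf.
- apply: eq_integral => x _; congr EFin.
  by rewrite !normal_pdfE// /normal_fun !subr0 sqrrN.
Qed.

(** A lower bound of the mass that a centered Gaussian law gives to the
    interval between one and two standard deviations. *)
Definition normal_mass : R := expR (- 2) / Num.sqrt (2 * pi).

Lemma normal_mass_gt0 : 0 < normal_mass.
Proof. by rewrite divr_gt0 ?expR_gt0// sqrtr_gt0 mulr_gt0// pi_gt0. Qed.

(** On [[s, 2 s]] the density is at least [exp(- 2)] times its peak, so that
    the mass of this interval is bounded below independently of [s]. *)
Lemma normal_prob_shell (s : R) : 0 < s ->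
  (normal_mass%:E <= normal_prob 0 s [set` `[s, (2 * s)%R]])%E.
Proof.
move=> s0; rewrite /normal_prob.
apply: (@le_trans _ _ (\int[mu]_(x in `[s, (2 * s)%R])
    (normal_peak s * expR (- 2))%:E)%E).
  rewrite integral_cst//= lebesgue_measure_itv/= lte_fin ifT; last by lra.
  rewrite -EFinB -EFinM lee_fin /normal_mass /normal_peak.
  rewrite (_ : 2 * s - s = s); last by ring.
  rewrite (_ : s ^+ 2 * pi *+ 2 = s ^+ 2 * (2 * pi)); last by ring.
  rewrite (sqrtrM _ (sqr_ge0 s)) sqrtr_sqr gtr0_norm// invfM.
  rewrite le_eqVlt; apply/orP; left; apply/eqP.
  rewrite [RHS]mulrC !mulrA divff ?gt_eqF// mul1r mulrC//.
apply: ge0_le_integral => //=.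
- by move=> x _; rewrite lee_fin mulr_ge0// ?normal_peak_ge0// expR_ge0.
- apply/measurable_EFinP; apply: measurable_funTS; exact: measurable_normal_pdf.
- move=> x; rewrite in_itv/= => /andP[sx x2s].
  rewrite lee_fin normal_pdfE ?gt_eqF//.
  apply: ler_wpM2l; first exact: normal_peak_ge0.
  rewrite /normal_fun ler_expR subr0 mulNr lerN2.
  rewrite ler_pdivrMr; last by rewrite mulrn_wgt0// exprn_gt0.
  nra.
Qed.

End normal_facts.

Section gaussian_charcos.
Context d (Omega : measurableType d) (R : realType) (P : probability Omega R).

(** Between one and two standard deviations, [y Y] lies in [[1/2, 2]], where
    the cosine is at most [cos (1/2)]. *)
Lemma charcos_normal_le y s (Y : {RV P >-> R}) : 0 < s ->
  (forall A : set R, measurable A -> P (Y @^-1` A) = normal_prob 0 s A) ->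
  1 / 2 <= `|y| * s <= 1 ->
  charcos P y Y <= 1 - normal_mass R * (1 - cos (1 / 2)).
Proof.
move=> s0 law /andP[ys1 ys2].
pose E := Y @^-1` [set` `[s, (2 * s)%R]].
have mE : measurable E by rewrite -[E]setTI; exact: measurable_funP.
have c1 : 0 <= 1 - cos (1 / 2 : R) by rewrite subr_ge0 cos_le1.
have PE : ((normal_mass R)%:E <= P E)%E.
  by rewrite /E law//; exact: normal_prob_shell.
have e1 : (\int[P]_w (1 - cos (y * Y w))%:E = (1 - charcos P y Y)%:E)%E.
  rewrite -mulN1r -integral_cos_affine.
  by apply: eq_integral => w _; rewrite mulN1r.
have m1 : measurable_fun setT (fun w => (1 - cos (y * Y w))%:E).
  apply/measurable_EFinP; apply: measurable_funB => //.
  by apply: measurable_cos_comp; exact: measurable_scaled.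
suff : ((normal_mass R * (1 - cos (1 / 2)))%:E <= (1 - charcos P y Y)%:E)%E.
  by rewrite lee_fin; lra.
rewrite -e1.
apply: (@le_trans _ _ (\int[P]_(w in E) (1 - cos (y * Y w))%:E)%E); last first.
  apply: ge0_subset_integral => //.
apply: (@le_trans _ _ (\int[P]_(w in E) (1 - cos (1 / 2))%:E)%E).
  rewrite integral_cst// EFinM muleC.
  by apply: lee_wpmul2l.
apply: ge0_le_integral => //.
- exact: measurable_funTS.
- move=> w; rewrite /E /= in_itv/= => /andP[sY Ys].
  rewrite lee_fin lerD2l lerN2 -(cos_norm (y * Y w)) normrM.
  have Y0 : 0 <= Y w by lra.
  rewrite (ger0_norm Y0).
  have h1 : 1 / 2 <= `|y| * Y w by apply: (le_trans ys1); exact: ler_wpM2l.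
  have h2 : `|y| * Y w <= 2.
    apply: (@le_trans _ _ (`|y| * (2 * s))); first exact: ler_wpM2l.
    by rewrite mulrCA; lra.
  have pi2 := pi_ge2 R.
  by rewrite leNgt ltr_cos ?in_itv/= -?leNgt//; apply/andP; split; lra.
Qed.

End gaussian_charcos.

Section gaussian_increments.
Context d (Omega : measurableType d) (R : realType) (P : probability Omega R).
Variables (X : R -> {RV P >-> R}) (V : R -> R).

Definition increment (s t : R) : {RV P >-> R} := (X t \- X s : {mfun _ >-> _}).

Definition gaussian_increments : Prop := forall s t, 0 <= s -> s < t -> t <= 1 ->
  forall A, measurable A ->
    P (increment s t @^-1` A) = normal_prob 0 (Num.sqrt (V t - V s)) A.

(** The increments are listed from the last to the first, which is the order
    in which [phase_sum] consumes them. *)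
Lemma increments_product_rule n (t : nat -> R) :
  independent_increments 1 X ->
  (forall i, (i <= n)%N -> t i \in `[0, 1]) ->
  (forall i, (i < n)%N -> t i < t i.+1) ->
  product_rule P n (fun k => increment (t (n - k.+1)%N) (t (n - k)%N)).
Proof.
move=> Hind t01 tlt A mA.
have := Hind n t t01 tlt (fun i : 'I_n => A (n - i.+1)%N) (fun i => mA _).
have -> : \bigcap_(i in [set: 'I_n]) ((X (t i.+1) \- X (t i)) @^-1` A (n - i.+1)%N) =
    \big[setI/setT]_(0 <= i < n)
      (increment (t (n - i.+1)%N) (t (n - i)%N) @^-1` A i).
  rewrite big_mkord -(bigcap_mkord n (fun i =>
    increment (t (n - i.+1)%N) (t (n - i)%N) @^-1` A i)).
  apply/seteqP; split => w /=.
    move=> h i /= ilt; have := h (rev_ord (Ordinal ilt)) I => /=.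
    by rewrite subnSK// (subKn (ltnW ilt)).
  move=> h i _; have := h (rev_ord i) (ltn_ord _) => /=.
  by rewrite (subKn (ltn_ord i)) subnSK// (subKn (ltnW (ltn_ord i))).
move=> ->; rewrite [RHS]big_nat_rev/= big_mkord; apply: eq_bigr => i _.
by rewrite add0n (subKn (ltn_ord i)) subnSK// (subKn (ltnW (ltn_ord i))).
Qed.

Hypothesis Hind : independent_increments 1 X.
Hypothesis HG : gaussian_increments.
Hypothesis Vmono : {in `[0, 1] &, {homo V : s t / s < t}}.
Hypothesis Vcont : {within [set` `[0, 1]], continuous V}.

Lemma increment_indep s r t : 0 <= s -> s < r -> r < t -> t <= 1 ->
  indep_pair P (increment s r) (increment r t).
Proof.
move=> s0 sr rt t1 A B mA mB.
pose tt i : R := if i is i'.+1 then if i' is _.+1 then t else r else s.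
have h1 i : (i <= 2)%N -> tt i \in `[0, 1].
  by move: i => [|[|i]] _ /=; rewrite in_itv/=; apply/andP; split; lra.
have h2 i : (i < 2)%N -> tt i < tt i.+1 by move: i => [|[|]].
have := @increments_product_rule 2 tt Hind h1 h2 (fun i => if i is 0%N then B else A).
rewrite !big_nat_recl// !big_nil /= setIT mule1 setIC muleC => h.
by apply: h; case.
Qed.

Lemma increment_sin0 y s t : 0 <= s -> s < t -> t <= 1 ->
  charsin P y (increment s t) = 0.
Proof.
move=> s0 st t1; apply: charsin_symmetric => A mA.
have mNA : measurable (-%R @^-1` A).
  by rewrite -[_ @^-1` _]setTI; exact: (@oppr_measurable R).
rewrite !HG// normal_prob_opp//.
rewrite gt_eqF// sqrtr_gt0 subr_gt0 Vmono// in_itv/=; apply/andP; split; lra.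
Qed.

Lemma increment_split y s r t : 0 <= s -> s < r -> r < t -> t <= 1 ->
  charcos P y (increment s t) =
  charcos P y (increment s r) * charcos P y (increment r t).
Proof.
move=> s0 sr rt t1.
rewrite -charcosD; [|exact: increment_indep|].
  by congr charcos; apply/funext => w /=; ring.
by apply: increment_sin0 => //; lra.
Qed.

(** By continuity of [V] there is a time [r] that halves the variance; the
    two halves are independent with the same law. *)
Lemma increment_halve y s t : 0 <= s -> s < t -> t <= 1 ->
  exists r, [/\ s < r, r < t, V r - V s = (V t - V s) / 2 &
    charcos P y (increment s t) = charcos P y (increment s r) ^+ 2].
Proof.
move=> s0 st t1.
have s01 : s \in `[0, 1] by rewrite in_itv/=; apply/andP; split; lra.
have t01 : t \in `[0, 1] by rewrite in_itv/=; apply/andP; split; lra.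
have Vst := Vmono s01 t01 st.
have sub : [set` `[s, t]] `<=` [set` `[0, 1]].
  by move=> x /=; rewrite !in_itv/= => /andP[? ?]; apply/andP; split; lra.
have [|r] := @IVT R V s t ((V s + V t) / 2) (ltW st) (continuous_subspaceW sub Vcont).
  rewrite (min_l (ltW Vst)) (max_r (ltW Vst)); apply/andP; split; lra.
rewrite in_itv/= => /andP[sr rt] Vr.
have sr' : s < r.
  rewrite lt_neqAle sr andbT; apply/eqP => e; move: Vr; rewrite -e; lra.
have rt' : r < t.
  rewrite lt_neqAle rt andbT; apply/eqP => e; move: Vr; rewrite e; lra.
exists r; split => //; first by lra.
rewrite (increment_split _ s0 sr' rt' t1) expr2; congr (_ * _).
apply: charcos_same_law => A mA.
have r0 : 0 <= r by lra.
have r1 : r <= 1 by lra.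
have e : V t - V r = V r - V s by lra.
by rewrite (HG s0 sr' r1 mA) (HG r0 rt' t1 mA) e.
Qed.

(** It is the square of a real number by [increment_halve]. *)
Lemma increment_ge0 y s t : 0 <= s -> s < t -> t <= 1 ->
  0 <= charcos P y (increment s t).
Proof.
by move=> s0 st t1; have [r [_ _ _ ->]] := increment_halve y s0 st t1; exact: sqr_ge0.
Qed.

Definition decay_rate : R := normal_mass R * (1 - cos (1 / 2)).

Lemma decay_rate_gt0 : 0 < decay_rate.
Proof.
rewrite /decay_rate mulr_gt0 ?normal_mass_gt0// subr_gt0 -[ltRHS](@cos0 R).
have pi2 := pi_ge2 R.
by rewrite ltr_cos ?in_itv/=; [lra|apply/andP; split; lra..].
Qed.

(** Halving the variance squares the characteristic function, so it is enough
    to gain a fixed factor when [y^2 (V t - V s)] lies in [[1/4, 1]]; there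
    [charcos_normal_le] applies. *)
Lemma increment_expdecay y s t : 0 <= s -> s < t -> t <= 1 ->
  1 / 4 <= y ^+ 2 * (V t - V s) ->
  charcos P y (increment s t) <= expR (- (decay_rate * (y ^+ 2 * (V t - V s)))).
Proof.
have [k] : exists k, y ^+ 2 * (V t - V s) <= 2 ^+ k.
  have [k hk] : exists k : nat, y ^+ 2 * (V t - V s) < k%:R.
    exists (Num.Def.archi_bound `|y ^+ 2 * (V t - V s)|).
    exact: (le_lt_trans (ler_norm _) (archi_boundP (normr_ge0 _))).
  exists k; apply: (le_trans (ltW hk)); rewrite -natrX ler_nat.
  exact: (ltnW (ltn_expl _ _)).
elim: k s t => [|k IH] s t hk s0 st t1 h4.
  have s01 : s \in `[0, 1] by rewrite in_itv/=; apply/andP; split; lra.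
  have t01 : t \in `[0, 1] by rewrite in_itv/=; apply/andP; split; lra.
  have Vst := Vmono s01 t01 st.
  have sV : 0 < Num.sqrt (V t - V s) by rewrite sqrtr_gt0 subr_gt0.
  apply: (@le_trans _ _ (1 - decay_rate)).
    apply: (charcos_normal_le sV); first by move=> A mA; exact: HG.
    have e : (`|y| * Num.sqrt (V t - V s)) ^+ 2 = y ^+ 2 * (V t - V s).
      by rewrite exprMn sqr_sqrtr ?subr_ge0 ?ltW// real_normK ?num_real.
    have p0 : 0 <= `|y| * Num.sqrt (V t - V s) by rewrite mulr_ge0// ltW.
    rewrite expr0 in hk.
    apply/andP; split.
      apply: ler_of_sqr => //; rewrite e; lra.
    apply: ler_of_sqr => //; rewrite e; lra.
  apply: le_trans (expR_ge1Dx _); rewrite lerD2l lerN2.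
  by rewrite expr0 in hk; rewrite ler_piMr// ltW// decay_rate_gt0.
have [h1|h1] := leP (y ^+ 2 * (V t - V s)) (2 ^+ k); first exact: IH.
have [r [sr rt Vr ->]] := increment_halve y s0 st t1.
have two_k : 1 <= (2 : R) ^+ k by apply: exprn_ege1; lra.
have := IH s r; rewrite Vr => /(_ _ s0 sr _ _).
rewrite (_ : y ^+ 2 * ((V t - V s) / 2) = y ^+ 2 * (V t - V s) / 2); last by rewrite mulrA.
move: hk; rewrite (exprS 2 k) => hk IHr.
have {}IHr := IHr ltac:(lra) ltac:(lra) ltac:(lra).
rewrite (_ : - (decay_rate * _) = - (decay_rate * (y ^+ 2 * (V t - V s) / 2)) * 2%:R);
  last by field.
rewrite expRM_natr; apply: lerXn2r IHr; rewrite nnegrE ?expR_ge0//.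
by apply: increment_ge0 => //; lra.
Qed.

Lemma increment_decay y s t : 0 <= s -> s < t -> t <= 1 ->
  charcos P y (increment s t) * (y ^+ 2 * (V t - V s)) <= decay_rate^-1 + 1.
Proof.
move=> s0 st t1; set u := y ^+ 2 * _; set c := charcos _ _ _.
have s01 : s \in `[0, 1] by rewrite in_itv/=; apply/andP; split; lra.
have t01 : t \in `[0, 1] by rewrite in_itv/=; apply/andP; split; lra.
have Vst := Vmono s01 t01 st.
have u0 : 0 <= u by rewrite mulr_ge0 ?sqr_ge0// subr_ge0 ltW.
have c0 : 0 <= c by exact: increment_ge0.
have c1 : c <= 1 by exact: charcos_le1.
have k0 := decay_rate_gt0.
have ki0 : 0 <= decay_rate^-1 by rewrite invr_ge0 ltW.
have [u4|u4] := leP (1 / 4) u; last by nra.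
have := increment_expdecay s0 st t1 u4; rewrite -/c -/u => h.
have h2 := expR_ge1Dx (decay_rate * u).
have e0 := expR_gt0 (decay_rate * u).
rewrite expRN in h.
have : c * (1 + decay_rate * u) <= 1.
  apply: (@le_trans _ _ (c * expR (decay_rate * u))); first exact: ler_wpM2l.
  by rewrite -ler_pdivlMr// div1r.
move=> h3; have : decay_rate * (c * u) <= 1 by nra.
by rewrite -ler_pdivlMl// mulr1 => h4; lra.
Qed.

End gaussian_increments.

(** * Consequences of the Hoelder condition *)

Section holder_inverse.
Context (R : realType).
Variables (V : R -> R) (a b gamma C : R).
Hypothesis ab : a < b.
Hypothesis gamma0 : 0 < gamma.
Hypothesis C0 : 0 < C.
Hypothesis Hlow : forall s t, a <= s -> s < t -> t <= b ->
  ((t - s) / C) `^ (gamma^-1) <= V t - V s.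

(** Cut [[a, b]] into [n] equal parts: if [gamma > 1], the increments of [V]
    over the parts sum to at least a constant times [n^(1 - 1/gamma)], which
    is unbounded. *)
Lemma holder_exponent_le1 : gamma <= 1.
Proof.
rewrite leNgt; apply/negP => g1.
pose c := ((b - a) / C) `^ (gamma^-1).
have c0 : 0 < c by rewrite powR_gt0// divr_gt0// subr_gt0.
pose dl : R := 1 - gamma^-1.
have dl0 : 0 < dl by rewrite subr_gt0 invf_lt1.
have H n : (0 < n)%N -> n%:R `^ dl * c <= V b - V a.
  move=> n0; have nR : 0 < n%:R :> R by rewrite ltr0n.
  pose t i : R := a + i%:R * ((b - a) / n%:R).
  have tn : t n = b by rewrite /t; field; rewrite gt_eqF.
  have -> : V b - V a = \sum_(0 <= i < n) (V (t i.+1) - V (t i)).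
    by rewrite telescope_sumr// tn /t mul0r addr0.
  have h0 : 0 < (b - a) / n%:R by rewrite divr_gt0// subr_gt0.
  rewrite (_ : n%:R `^ dl * c = \sum_(0 <= i < n) ((b - a) / n%:R / C) `^ gamma^-1);
    last first.
    have bC : 0 <= (b - a) / C by rewrite divr_ge0 ?ltW// subr_gt0.
    have ni : 0 <= n%:R^-1 :> R by rewrite invr_ge0 ltW.
    have -> : (b - a) / n%:R / C = ((b - a) / C) * n%:R^-1 by rewrite mulrAC.
    rewrite sumr_const_nat subn0 -[RHS]mulr_natl (powRM _ bC ni) -/c.
    have -> : n%:R^-1 `^ gamma^-1 = n%:R `^ (- gamma^-1).
      by rewrite -powR_inv1 ?ltW// -powRrM mulN1r.
    rewrite mulrCA mulrC; congr (_ * _).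
    rewrite -{2}(powRr1 (ltW nR)) -powRD//.
    by rewrite (gt_eqF nR) implybT.
  apply: ler_sum_nat => i /andP[_ ilt].
  have e : t i.+1 - t i = (b - a) / n%:R by rewrite /t -natr1; ring.
  rewrite -e; apply: Hlow.
  - by rewrite lerDl mulr_ge0// ltW.
  - by rewrite -subr_gt0 e.
  - rewrite -tn lerD2l; apply: ler_wpM2r; first exact: ltW.
    by rewrite ler_nat.
pose M := (V b - V a) / c.
have M0 : 0 <= M.
  rewrite divr_ge0 ?ltW//; apply: lt_le_trans (H 1%N isT); rewrite mulr_gt0// powR_gt0//.
pose n := (Num.Def.archi_bound (M `^ dl^-1)).+1.
have nM : M `^ dl^-1 < n%:R.
  apply: (lt_trans (archi_boundP (powR_ge0 _ _))); by rewrite ltr_nat.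
have := H n isT; rewrite -ler_pdivlMr// -/M leNgt => /negP; apply.
have -> : M = (M `^ dl^-1) `^ dl.
  by rewrite -powRrM mulVf ?powRr1// lt0r_neq0.
by apply: (gt0_ltr_powR dl0 _ _ nM); rewrite nnegrE ?powR_ge0.
Qed.

End holder_inverse.

Section mean_bound.
Context d (Omega : measurableType d) (R : realType) (P : probability Omega R).
Variables (X : R -> {RV P >-> R}) (V : R -> R) (a b gamma C : R).
Hypothesis Hind : independent_increments 1 X.
Hypothesis HG : gaussian_increments X V.
Hypothesis Vmono : {in `[0, 1] &, {homo V : s t / s < t}}.
Hypothesis Vcont : {within [set` `[0, 1]], continuous V}.
Hypothesis a0 : 0 <= a.
Hypothesis ab : a < b.
Hypothesis b1 : b <= 1.
Hypothesis gamma0 : 0 < gamma.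
Hypothesis C0 : 0 < C.
Hypothesis Hlow : forall s t, a <= s -> s < t -> t <= b ->
  ((t - s) / C) `^ (gamma^-1) <= V t - V s.

Definition grid (n i : nat) : R := a + i%:R * ((b - a) / n%:R).

Lemma grid_lt n i j : (0 < n)%N -> (i < j)%N -> grid n i < grid n j.
Proof.
move=> n0 ij; rewrite ltrD2l ltr_pM2r ?ltr_nat// divr_gt0// ?subr_gt0//.
by rewrite ltr0n.
Qed.

Lemma grid_n n : (0 < n)%N -> grid n n = b.
Proof. by move=> n0; rewrite /grid; field; rewrite pnatr_eq0 -lt0n. Qed.

Lemma grid_le n i : (0 < n)%N -> (i <= n)%N -> a <= grid n i <= b.
Proof.
move=> n0 ilt; have h0 : 0 <= (b - a) / n%:R by rewrite divr_ge0// subr_ge0 ltW.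
rewrite lerDl mulr_ge0//=; rewrite -[leRHS](grid_n n0) lerD2l.
by apply: ler_wpM2r => //; rewrite ler_nat.
Qed.

Definition rev_increment (n k : nat) : {RV P >-> R} :=
  increment X (grid n (n - k.+1)) (grid n (n - k)).

Definition rev_charcos (n : nat) (y : R) (k : nat) : R :=
  charcos P y (rev_increment n k).

Lemma rev_lt n k : (0 < n)%N -> (k < n)%N ->
  [/\ 0 <= grid n (n - k.+1), grid n (n - k.+1) < grid n (n - k) & grid n (n - k) <= 1].
Proof.
move=> n0 kn; have /andP[h1 h2] := grid_le n0 (leq_subr k.+1 n).
have /andP[h3 h4] := grid_le n0 (leq_subr k n).
by split; [exact: le_trans h1|by apply: grid_lt => //;
  rewrite -(subnSK kn)|exact: le_trans b1].
Qed.

Lemma rev_charcos01 n y k : (0 < n)%N -> (k < n)%N -> 0 <= rev_charcos n y k <= 1.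
Proof.
move=> n0 kn; have [h1 h2 h3] := rev_lt n0 kn.
by rewrite (increment_ge0 Hind HG Vmono Vcont)//= charcos_le1.
Qed.

(** The common decay exponent of [mean_sum] in both frequency variables. It
    balances the cutoff in [mean_bound_y]. *)
Definition sum_exponent : R := 2 * gamma / (1 + gamma).

Lemma mean_bound_x n x y r K : (0 < n)%N -> 1 <= r -> r <= `|x| ->
  `|x * ((b - a) / n%:R)| <= 1 -> 2 / (cos 1 * (b - a)) <= K ->
  forall k, (k <= n)%N ->
  (mean_sum (x * ((b - a) / n%:R)) (rev_charcos n y) k).1 ^+ 2 +
  (mean_sum (x * ((b - a) / n%:R)) (rev_charcos n y) k).2 ^+ 2
  <= (n%:R * (K * r `^ (- sum_exponent))) ^+ 2.
Proof.
move=> n0 r1 rx xh hK k kn.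
have [a0' ab' b1' g0' C0'] := And5 a0 ab b1 gamma0 C0.
have g1 := holder_exponent_le1 ab gamma0 C0 Hlow.
have c1 := @cos1_gt0 R.
have ba : 0 < b - a by rewrite subr_gt0.
have nR : 0 < n%:R :> R by rewrite ltr0n.
have := mean_sum_small_phase (fun k => @rev_charcos01 n y k n0) kn xh.
set S := (X in _ * X <= 4); set B := x * _ => hS.
set N := n%:R * _.
have rb : r^-1 <= r `^ (- sum_exponent).
  rewrite -powR_inv1; last by lra.
  apply: ler_powR => //; rewrite lerN2 /sum_exponent ler_pdivrMr ?mul1r; lra.
have K0 : 0 <= K by apply: le_trans hK; rewrite divr_ge0// mulr_ge0// ltW.
have hB : 2 <= cos 1 * `|B| * N.
  rewrite /B normrM (ger0_norm (ltW (divr_gt0 ba nR))) /N.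
  rewrite (_ : cos 1 * (`|x| * ((b - a) / n%:R)) * (n%:R * (K * r `^ (- sum_exponent)))
     = (cos 1 * (b - a) * K) * (`|x| * r `^ (- sum_exponent))); last first.
    by field; rewrite gt_eqF.
  have h1 : 2 <= cos 1 * (b - a) * K by rewrite -ler_pdivrMl ?mulr_gt0// mulrC.
  have h2 : 1 <= `|x| * r `^ (- sum_exponent).
    apply: (@le_trans _ _ (r * r^-1)); first by rewrite divff//; lra.
    by apply: ler_pM => //; [lra|rewrite invr_ge0; lra].
  nra.
have B0 : 0 < (cos 1 * B) ^+ 2.
  have x0 : x != 0 by rewrite -normr_gt0; lra.
  by rewrite exprn_even_gt0//= !mulf_neq0// ?invr_neq0// ?gt_eqF.
rewrite -(ler_pM2l B0); apply: (le_trans hS).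
rewrite exprMn -(real_normK (num_real B)) -!exprMn.
have -> : 4 = 2 ^+ 2 :> R by ring.
by rewrite lerXn2r// nnegrE//; apply: le_trans hB.
Qed.

(** The times closer than [r^(- sum_exponent)] contribute at most their
    number; for the others the characteristic function is at most [eps], which
    is of the same order by the choice of the exponent. *)
Lemma mean_bound_y n x y r K : (0 < n)%N -> 1 <= r -> r <= `|y| ->
  r `^ sum_exponent <= n%:R ->
  (b - a)^-1 + 1 + ((decay_rate R)^-1 + 1) * C `^ gamma^-1 <= K ->
  forall k, (k <= n)%N ->
  (mean_sum (x * ((b - a) / n%:R)) (rev_charcos n y) k).1 ^+ 2 +
  (mean_sum (x * ((b - a) / n%:R)) (rev_charcos n y) k).2 ^+ 2
  <= (n%:R * (K * r `^ (- sum_exponent))) ^+ 2.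
Proof.
move=> n0 r1 ry rn hK k kn.
have [a0' ab' b1' g0' C0'] := And5 a0 ab b1 gamma0 C0.
have ba : 0 < b - a by rewrite subr_gt0.
have nR : 0 < n%:R :> R by rewrite ltr0n.
have h0 : 0 < (b - a) / n%:R by rewrite divr_gt0.
have r0 : 0 < r by lra.
have y0 : 0 < y ^+ 2.
  by rewrite -real_normK ?num_real// exprn_gt0//; lra.
have [s0 hS] := mean_sum_abs (x * ((b - a) / n%:R)) (fun k => @rev_charcos01 n y k n0) kn.
apply: (le_trans hS).
have dr := decay_rate_gt0 R.
set rho := r `^ (- sum_exponent).
have rho0 : 0 < rho by rewrite powR_gt0.
suff h : abs_sum (rev_charcos n y) k <= n%:R * (K * rho).
  by rewrite lerXn2r// nnegrE//; apply: le_trans h.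
(* The diagonal value is that of a zero increment. *)
pose D i j : R := if i == j then 1 else charcos P y (increment X (grid n i) (grid n j)).
have Dgt i j : (i < j)%N -> D i j = charcos P y (increment X (grid n i) (grid n j)).
  by move=> ij; rewrite /D ltn_eqF.
rewrite (@abs_sum_expand _ _ n D); last 4 first.
- by move=> i; rewrite /D eqxx.
- move=> i j l /andP[ij jl] ln.
  have [<-|ij'] := eqVneq i j; first by rewrite {1}/D eqxx mul1r.
  have [<-|jl'] := eqVneq j l; first by rewrite [X in _ * X]/D eqxx mulr1.
  have lij : (i < j)%N by rewrite ltn_neqAle ij'.
  have ljl : (j < l)%N by rewrite ltn_neqAle jl'.
  rewrite !Dgt//; last exact: ltn_trans ljl.
  have /andP[h1 h2] := grid_le n0 (leq_trans (leq_trans ij jl) ln).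
  have /andP[h3 h4] := grid_le n0 ln.
  by rewrite -(increment_split Hind HG Vmono)//; [lra|exact: grid_lt|exact: grid_lt|lra].
- by move=> j jn; rewrite Dgt// -(subnSK jn).
- by [].
(* The cutoff in time, the number of grid steps below it, the variance that
   the Hoelder condition guarantees beyond it, and the resulting bound of the
   characteristic function. *)
pose hh := rho.
pose i0 := (Num.truncn (hh / ((b - a) / n%:R))).+1.
pose eta := (hh / C) `^ gamma^-1.
have eta0 : 0 < eta by rewrite powR_gt0// divr_gt0.
pose eps := ((decay_rate R)^-1 + 1) / (y ^+ 2 * eta).
have dr0 : 0 <= (decay_rate R)^-1 + 1 by rewrite addr_ge0// invr_ge0 ltW.
have eps0 : 0 <= eps by rewrite divr_ge0// mulr_ge0// ltW.
apply: (le_trans (@sum_cutoff _ _ i0 k eps eps0 _ _)).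
- move=> i ik; rewrite /D; case: ifP => // _; exact: charcos_le1.
- move=> i ik i0i; have i_gt0 : (0 < i)%N by apply: leq_trans i0i.
  have lt_nk : (n - k < n - k + i)%N by rewrite -[ltnLHS]addn0 ltn_add2l.
  rewrite Dgt//.
  have lin : (n - k + i <= n)%N by rewrite -[leqRHS](subnK kn) leq_add2l ltnW.
  have /andP[h1 h2] := grid_le n0 lin.
  have /andP[h3 h4] := grid_le n0 (leq_subr k n).
  have lt12 : grid n (n - k) < grid n (n - k + i) by exact: grid_lt.
  have gd : grid n (n - k + i) - grid n (n - k) = i%:R * ((b - a) / n%:R).
    by rewrite /grid natrD; ring.
  have hV : eta <= V (grid n (n - k + i)) - V (grid n (n - k)).
    apply: le_trans (Hlow h3 lt12 h2); rewrite /eta.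
    have hts : hh / C <= (grid n (n - k + i) - grid n (n - k)) / C.
      rewrite ler_pM2r ?invr_gt0// gd -ler_pdivrMr//.
      by apply: ltW; apply: lt_le_trans (truncnS_gt _) _; rewrite ler_nat.
    apply: (ge0_ler_powR _ _ _ hts); rewrite ?nnegrE.
    - by rewrite invr_ge0 ltW.
    - by rewrite divr_ge0// ltW.
    - by rewrite divr_ge0 ?subr_ge0// ltW.
  have s0' : 0 <= grid n (n - k) by exact: le_trans h3.
  have t1' : grid n (n - k + i) <= 1 by exact: le_trans b1.
  have hd := increment_decay Hind HG Vmono Vcont y s0' lt12 t1'.
  rewrite /eps (ler_pdivlMr _ _ (mulr_gt0 y0 eta0)); apply: le_trans hd.
  apply: ler_wpM2l; last by rewrite ler_pM2l.
  exact: (increment_ge0 Hind HG Vmono Vcont).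
have hi0 : i0%:R <= n%:R * rho * (b - a)^-1 + 1.
  rewrite /i0 -natr1 lerD2r.
  apply: (@le_trans _ _ (hh / ((b - a) / n%:R))); first by rewrite truncn_le divr_ge0// ltW.
  by rewrite /hh le_eqVlt; apply/orP; left; apply/eqP; field; rewrite !gt_eqF.
have h1n : 1 <= n%:R * rho.
  by rewrite /rho powRN -ler_pdivrMr ?invr_gt0 ?powR_gt0// invrK mul1r.
have heps : eps <= ((decay_rate R)^-1 + 1) * C `^ gamma^-1 * rho.
  rewrite /eps -mulrA; apply: ler_wpM2l => //.
  rewrite -[leRHS]invrK lef_pV2 ?posrE; last 2 first.
  - exact: mulr_gt0.
  - by rewrite invr_gt0 mulr_gt0// powR_gt0.
  rewrite invfM (_ : rho^-1 = r `^ sum_exponent); last by rewrite /rho powRN invrK.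
  have -> : eta = (C `^ gamma^-1)^-1 * r `^ (- sum_exponent / gamma).
    rewrite /eta /hh powRM ?invr_ge0 ?ltW// mulrC; congr (_ * _).
      by rewrite -powR_inv1 ?ltW// -powRrM mulN1r powRN.
    by rewrite /rho -powRrM.
  rewrite mulrCA; apply: ler_wpM2l; first by rewrite invr_ge0 powR_ge0.
  apply: (@le_trans _ _ (r `^ 2 * r `^ (- sum_exponent / gamma))).
    rewrite -powRD; last by rewrite (gt_eqF r0) implybT.
    rewrite le_eqVlt; apply/orP; left; apply/eqP; congr (_ `^ _).
    by rewrite /sum_exponent; field; apply/andP; split; rewrite gt_eqF//; lra.
  apply: ler_wpM2r; first exact: powR_ge0.
  rewrite (powR_mulrn _ (ltW r0)) -(real_normK (num_real y)).
  by rewrite lerXn2r// nnegrE// ltW.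
have kn' : k%:R * eps <= n%:R * (((decay_rate R)^-1 + 1) * C `^ gamma^-1 * rho).
  by apply: ler_pM => //; rewrite ler_nat.
have hK' : n%:R * rho * ((b - a)^-1 + 1 + ((decay_rate R)^-1 + 1) * C `^ gamma^-1)
  <= n%:R * rho * K.
  by apply: ler_wpM2l => //; rewrite mulr_ge0// ltW.
rewrite (_ : n%:R * (K * rho) = n%:R * rho * K); last by ring.
apply: le_trans hK'; move: hi0 h1n kn'; set ee := k%:R * eps; set cc := _ * C `^ _.
set ii := (b - a)^-1; lra.
Qed.

End mean_bound.

(** * Tails of the discretized Fourier transform *)

Section relative_sums.
Context (R : realType).

(** The real and imaginary parts of the sum of [exp(i (x t_j + y f(t_j)))], up
    to the phase at the left endpoint [a]. Normalizing by [f a] leaves only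
    increments of the path after [a], since [X_a] itself is random when
    [a > 0]. *)
Definition rel_cos (a h : R) (f : R -> R) (x y : R) (n : nat) : R :=
  \sum_(0 <= i < n) cos (x * (i%:R * h) + y * (f (a + i%:R * h) - f a)).

Definition rel_sin (a h : R) (f : R -> R) (x y : R) (n : nat) : R :=
  \sum_(0 <= i < n) sin (x * (i%:R * h) + y * (f (a + i%:R * h) - f a)).

End relative_sums.

Section tail.
Context d (Omega : measurableType d) (R : realType) (P : probability Omega R).
Variables (X : R -> {RV P >-> R}) (V : R -> R) (a b gamma C : R).
Hypothesis Hind : independent_increments 1 X.
Hypothesis HG : gaussian_increments X V.
Hypothesis Vmono : {in `[0, 1] &, {homo V : s t / s < t}}.
Hypothesis Vcont : {within [set` `[0, 1]], continuous V}.
Hypothesis a0 : 0 <= a.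
Hypothesis ab : a < b.
Hypothesis b1 : b <= 1.
Hypothesis gamma0 : 0 < gamma.
Hypothesis C0 : 0 < C.
Hypothesis Hlow : forall s t, a <= s -> s < t -> t <= b ->
  ((t - s) / C) `^ (gamma^-1) <= V t - V s.

(** A step of [phase_sum] multiplies the sum over the times from [n - k] on
    by the phase of the increment before [n - k] and adds the term of the
    new initial time. *)
Lemma phase_sum_rev n x y k w : (k <= n)%N ->
  phase_sum (x * ((b - a) / n%:R)) y (rev_increment X a b n) k w =
  (\sum_(0 <= i < k) cos (x * (i%:R * ((b - a) / n%:R)) +
      y * (X (grid a b n (n - k + i)) w - X (grid a b n (n - k)) w)),
   \sum_(0 <= i < k) sin (x * (i%:R * ((b - a) / n%:R)) +
      y * (X (grid a b n (n - k + i)) w - X (grid a b n (n - k)) w))).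
Proof.
elim: k => [|k IH] kn; first by rewrite !big_nil.
have -> : phase_sum (x * ((b - a) / n%:R)) y (rev_increment X a b n) k.+1 w =
    rot_step (x * ((b - a) / n%:R)) y
      (phase_sum (x * ((b - a) / n%:R)) y (rev_increment X a b n) k w,
       rev_increment X a b n k w) by [].
rewrite (IH (ltnW kn)) /rot_step /=.
set h := (b - a) / n%:R.
have e i : x * (i.+1%:R * h)
  + y * (X (grid a b n (n - k.+1 + i.+1)) w - X (grid a b n (n - k.+1)) w)
  = (x * h + y * (X (grid a b n (n - k)) w - X (grid a b n (n - k.+1)) w))
  + (x * (i%:R * h) + y * (X (grid a b n (n - k + i)) w - X (grid a b n (n - k)) w)).
  by rewrite addnS -addSn subnSK// -natr1; ring.
congr (_, _).
  rewrite big_nat_recl// mul0r mulr0 addn0 subrr mulr0 addr0 cos0; congr (_ + _).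
  rewrite !mulr_sumr -sumrB; apply: eq_bigr => i _.
  by rewrite e [RHS]cosD.
rewrite big_nat_recl// mul0r mulr0 addn0 subrr mulr0 addr0 sin0 add0r.
rewrite !mulr_sumr -big_split; apply: eq_bigr => i _.
by rewrite e [RHS]sinD.
Qed.

Lemma phase_sum_rel n x y w :
  phase_sum (x * ((b - a) / n%:R)) y (rev_increment X a b n) n w =
  (rel_cos a ((b - a) / n%:R) (X ^~ w) x y n,
   rel_sin a ((b - a) / n%:R) (X ^~ w) x y n).
Proof.
rewrite phase_sum_rev// /rel_cos /rel_sin subnn.
have -> : grid a b n 0 = a by rewrite /grid mul0r addr0.
by congr (_, _); apply: eq_bigr => i _; rewrite add0n.
Qed.

Definition large_sum (x y s : R) (n : nat) : set Omega :=
  [set w | s * n%:R <= `|rel_cos a ((b - a) / n%:R) (X ^~ w) x y n| \/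
           s * n%:R <= `|rel_sin a ((b - a) / n%:R) (X ^~ w) x y n|].

Definition one_sided (x y t alpha : R) (n : nat) : set Omega :=
  [set w | t <= cos alpha * rel_cos a ((b - a) / n%:R) (X ^~ w) x y n -
                sin alpha * rel_sin a ((b - a) / n%:R) (X ^~ w) x y n].

Lemma measurable_one_sided x y t alpha n : measurable (one_sided x y t alpha n).
Proof.
have mX : measurable_fun setT
  (fun w => cos alpha * rel_cos a ((b - a) / n%:R) (X ^~ w) x y n -
                sin alpha * rel_sin a ((b - a) / n%:R) (X ^~ w) x y n).
  rewrite (_ : (fun w => _)
    = (fun w => cos alpha * (phase_sum (x * ((b - a) / n%:R)) y (rev_increment X a b n)
      n w).1
    - sin alpha * (phase_sum (x * ((b - a) / n%:R)) y (rev_increment X a b n) n w).2));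
      last first.
    by apply/funext => w; rewrite phase_sum_rel.
  apply: measurable_funB; apply: measurable_funM => //.
    exact: (measurableT_comp measurable_fst (measurable_funPT _)).
  exact: (measurableT_comp measurable_snd (measurable_funPT _)).
have := mX measurableT [set` `[t, +oo[] (measurable_itv _).
rewrite setTI; congr measurable; apply/seteqP; split => w /=; by rewrite in_itv/= andbT.
Qed.

(** The four angles give the upper and lower tails of the real and of
    the imaginary part. *)
Lemma large_sumE x y s n : large_sum x y s n =
  one_sided x y (s * n%:R) 0 n `|` one_sided x y (s * n%:R) pi n `|`
  (one_sided x y (s * n%:R) (pi / 2) n `|` one_sided x y (s * n%:R) (- (pi / 2)) n).
Proof.
rewrite /large_sum /one_sided; apply/seteqP; split => w /=;
  rewrite cos0 sin0 cospi sinpi cosN sinN cos_pihalf sin_pihalf !mul0r !mul1r !mulN1r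
    !subr0 !sub0r opprK !ler_normr.
  by move=> [/orP[|]|/orP[|]]; tauto.
by move=> [[->|->]|[->|->]]; rewrite ?orbT; [left|left|right|right].
Qed.

(** The Chernoff bound at [lam = 1/(4 n sqrt K)]: this is the largest order
    that [4 lam (n K) <= 1] and a bounded variance term
    [4 lam^2 n (n K)] both permit. *)
Lemma one_sided_tail x y s alpha n K : (0 < n)%N -> 0 < K -> K <= 1 ->
  (forall k, (k <= n)%N ->
    (mean_sum (x * ((b - a) / n%:R)) (rev_charcos X a b n y) k).1 ^+ 2 +
    (mean_sum (x * ((b - a) / n%:R)) (rev_charcos X a b n y) k).2 ^+ 2
    <= (n%:R * K) ^+ 2) ->
  (P (one_sided x y (s * n%:R) alpha n) <= (expR (1 / 2 - s / (4 * Num.sqrt K)))%:E)%E.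
Proof.
move=> n0 K0 K1 hG.
have nR : 0 < n%:R :> R by rewrite ltr0n.
set q := Num.sqrt K.
have q0 : 0 < q by rewrite sqrtr_gt0.
have qK : q ^+ 2 = K by rewrite sqr_sqrtr// ltW.
have q1 : q <= 1 by apply: ler_of_sqr => //; rewrite qK expr1n.
pose lam := (4 * n%:R * q)^-1.
have lam0 : 0 < lam by rewrite invr_gt0 !mulr_gt0.
have G0 : 0 <= n%:R * K by rewrite mulr_ge0// ltW.
have e1 : lam * (n%:R * K) = q / 4.
  by rewrite /lam -qK; field; rewrite !gt_eqF.
have lamG : 4 * lam * (n%:R * K) <= 1.
  by rewrite -mulrA e1; lra.
have WP : product_rule P n (fun k => rev_increment X a b n k : Omega -> R).
  apply: (@increments_product_rule _ _ _ _ X n (grid a b n) Hind).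
    move=> i ile; have /andP[h1 h2] := grid_le ab n0 ile.
    by rewrite in_itv/= (le_trans a0 h1) (le_trans h2 b1).
  by move=> i ilt; exact: grid_lt.
have chi0 k : (k < n)%N -> 0 <= rev_charcos X a b n y k.
  by move=> kn; have /andP[] := rev_charcos01 Hind HG Vmono Vcont a0 ab b1 y n0 kn.
have hs k : (k < n)%N -> charsin P y (rev_increment X a b n k) = 0.
  move=> kn; have [h1 h2 h3] := rev_lt a0 ab b1 n0 kn.
  exact: (increment_sin0 HG Vmono).
have := phase_sum_tail G0 hG WP chi0 hs alpha (s * n%:R) lam0 lamG.
under eq_set do rewrite phase_sum_rel.
move/le_trans; apply; rewrite lee_fin ler_expR.
have -> : 4 * lam ^+ 2 * n%:R * (n%:R * K) = 1 / 4.
  by rewrite /lam -qK; field; rewrite !gt_eqF.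
have -> : lam * (s * n%:R) = s / (4 * q) by rewrite /lam; field; rewrite !gt_eqF.
rewrite e1; lra.
Qed.

Lemma large_sum_tail x y s n K : (0 < n)%N -> 0 < K -> K <= 1 ->
  (forall k, (k <= n)%N ->
    (mean_sum (x * ((b - a) / n%:R)) (rev_charcos X a b n y) k).1 ^+ 2 +
    (mean_sum (x * ((b - a) / n%:R)) (rev_charcos X a b n y) k).2 ^+ 2
    <= (n%:R * K) ^+ 2) ->
  (P (large_sum x y s n) <= (4 * expR (1 / 2 - s / (4 * Num.sqrt K)))%:E)%E.
Proof.
move=> n0 K0 K1 hG; rewrite large_sumE.
have h alpha := one_sided_tail s alpha n0 K0 K1 hG.
have m := fun alpha => measurable_one_sided x y (s * n%:R) alpha n.
set e := expR _ in h *.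
have U A B : measurable A -> measurable B -> (P (A `|` B) <= P A + P B)%E.
  by move=> mA mB; exact: measureU2.
apply: (le_trans (U _ _ _ _)); [exact: measurableU|exact: measurableU|].
rewrite (_ : (4 * e)%:E = (e%:E + e%:E + (e%:E + e%:E))%E); last first.
  by rewrite -!EFinD; congr EFin; ring.
apply: leeD; apply: (le_trans (U _ _ (m _) (m _))); exact: leeD.
Qed.

(** The limit inferior of the events [large_sum]. Its probability is bounded
    by those of the events for large [n], and outside it infinitely many
    of the sums are small, which suffices to bound their limit. *)
Definition persistently_large (x y s : R) : set Omega :=
  \bigcup_m \bigcap_(n in [set n | (m <= n)%N]) large_sum x y s n.

Lemma measurable_large_sum x y s n : measurable (large_sum x y s n).
Proof. by rewrite large_sumE; do 2?apply: measurableU; exact: measurable_one_sided. Qed.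

Lemma measurable_persistently_large x y s : measurable (persistently_large x y s).
Proof.
apply: bigcup_measurable => m _; apply: bigcap_measurable => [|n _].
  by exists m => /=.
exact: measurable_large_sum.
Qed.

Lemma persistently_large_le x y s (e : \bar R) n0 :
  (forall n, (n0 <= n)%N -> (P (large_sum x y s n) <= e)%E) ->
  (P (persistently_large x y s) <= e)%E.
Proof.
move=> H; pose F m := \bigcap_(n in [set n | (m <= n)%N]) large_sum x y s n.
have mF m : measurable (F m).
  apply: bigcap_measurable => [|n _]; first by exists m => /=.
  exact: measurable_large_sum.
have ndF : nondecreasing_seq F.
  move=> i j ij; apply/subsetPset => w h n /= jn; apply: h => /=; exact: leq_trans jn.
have cF : P \o F @ \oo --> P (\bigcup_n F n).
  by apply: nondecreasing_cvg_mu => //; exact: bigcup_measurable.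
rewrite /persistently_large -(cvg_lim _ cF)//.
apply: lime_le; first by apply/cvg_ex; exists (P (\bigcup_n F n)).
apply: nearW => m.
apply: (le_trans _ (H (maxn m n0) (leq_maxr _ _))).
apply: le_measure; rewrite ?inE//; first exact: measurable_large_sum.
by move=> w; apply => /=; exact: leq_maxl.
Qed.

Definition decay_constant : R := 2 / (cos 1 * (b - a)) +
  ((b - a)^-1 + 1 + ((decay_rate R)^-1 + 1) * C `^ gamma^-1).

Lemma persistently_large_tail x y r s : 1 <= r -> r <= `|x| \/ r <= `|y| ->
  decay_constant * r `^ (- sum_exponent gamma) <= 1 ->
  (P (persistently_large x y s) <= (4 * expR (1 / 2 - s /
    (4 * Num.sqrt (decay_constant * r `^ (- sum_exponent gamma)))))%:E)%E.
Proof.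
move=> r1 rxy K1; set K := decay_constant * _ in K1 *.
have ba : 0 < b - a by rewrite subr_gt0.
have c1 := @cos1_gt0 R.
have k1 : 0 < 2 / (cos 1 * (b - a)) by rewrite divr_gt0// mulr_gt0.
have k2 : 0 < (b - a)^-1 by rewrite invr_gt0.
have k3 : 0 <= ((decay_rate R)^-1 + 1) * C `^ gamma^-1.
  by rewrite mulr_ge0 ?powR_ge0// addr_ge0// invr_ge0 ltW// decay_rate_gt0.
have kx : 2 / (cos 1 * (b - a)) <= decay_constant by rewrite /decay_constant; lra.
have ky : (b - a)^-1 + 1 + ((decay_rate R)^-1 + 1) * C `^ gamma^-1 <= decay_constant.
  by rewrite /decay_constant lerDr ltW.
have K0 : 0 < K by rewrite mulr_gt0 ?powR_gt0//; lra.
have [n0 hn0] : exists n0 : nat, forall n, (n0 <= n)%N -> [/\ (0 < n)%N,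
   r `^ sum_exponent gamma <= n%:R & `|x * ((b - a) / n%:R)| <= 1].
  pose A := r `^ sum_exponent gamma + `|x * (b - a)|.
  have A0 : 0 <= A by rewrite addr_ge0 ?powR_ge0.
  exists (Num.Def.archi_bound A) => n hn.
  have hA : A < n%:R by apply: lt_le_trans (archi_boundP A0) _; rewrite ler_nat.
  have n0 : 0 < n%:R :> R by apply: le_lt_trans hA.
  split; first by rewrite -(ltr0n R).
    by apply: ltW; apply: le_lt_trans hA; rewrite lerDl.
  rewrite mulrA normrM normfV (ger0_norm (ltW n0)) ler_pdivrMr// mul1r.
  by apply: ltW; apply: le_lt_trans hA; rewrite lerDr powR_ge0.
apply: (@persistently_large_le _ _ _ _ n0) => n /hn0[n_gt0 hn1 hn2].
apply: large_sum_tail => // k kn; case: rxy => hr.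
- exact: (@mean_bound_x _ _ _ P X V a b gamma C Hind HG Vmono Vcont a0 ab b1 gamma0 C0
  Hlow n x y r).
- exact: (@mean_bound_y _ _ _ P X V a b gamma C Hind HG Vmono Vcont a0 ab b1 gamma0 C0
  Hlow n x y r).
Qed.

End tail.

(** * The Borel-Cantelli argument *)

Section borel_cantelli.
Context (R : realType).

Lemma powR_le_expR (u : R) (p : nat) : (0 < p)%N -> 0 <= u ->
  (u / p%:R) ^+ p <= expR u.
Proof.
move=> p0 u0; have pR : 0 < p%:R :> R by rewrite ltr0n.
have up : 0 <= u / p%:R by rewrite divr_ge0// ltW.
rewrite -[X in _ <= expR X](divfK (lt0r_neq0 pR) u) expRM_natr.
rewrite lerXn2r// ?nnegrE ?expR_ge0//.
by apply: le_trans (expR_ge1Dx _); rewrite lerDr.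
Qed.

(** Compare the exponential with its power of exponent [p >= 6 / eps]. *)
Lemma expR_beats_poly (A c eps : R) : 0 < A -> 0 < c -> 0 < eps ->
  exists N0 : R, forall N, N0 <= N -> A * N ^+ 5 * expR (- (c * N `^ eps)) <= 1.
Proof.
move=> A0 c0 e0.
pose p := (Num.Def.archi_bound (6 / eps)).
have hp : 6 / eps < p%:R by apply: archi_boundP; rewrite divr_ge0// ltW.
have pR : 0 < p%:R :> R by apply: le_lt_trans hp; rewrite divr_ge0// ltW.
have p0 : (0 < p)%N by rewrite -(ltr0n R).
pose D := A * (p%:R / c) ^+ p.
exists (D + 1) => N hN.
have D0 : 0 <= D by rewrite mulr_ge0 ?exprn_ge0 ?divr_ge0// ltW.
have N1 : 1 <= N by lra.
have N0 : 0 < N by lra.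
have u0 : 0 < c * N `^ eps by rewrite mulr_gt0 ?powR_gt0.
rewrite expRN ler_pdivrMr ?expR_gt0// mul1r.
apply: le_trans (powR_le_expR p0 (ltW u0)).
have N6 : N ^+ 6 <= (N `^ eps) ^+ p.
  rewrite -(powR_mulrn p (powR_ge0 N eps)) -powRrM -(powR_mulrn 6 (ltW N0)).
  by apply: ler_powR => //; rewrite mulrC -ler_pdivrMr// ltW.
rewrite (_ : c * N `^ eps / p%:R = (p%:R / c)^-1 * N `^ eps);
  last by rewrite invf_div mulrAC.
rewrite exprMn.
have q0 : 0 < (p%:R / c) ^+ p by rewrite exprn_gt0// divr_gt0.
rewrite exprVn -ler_pdivrMl ?invr_gt0// invrK.
apply: le_trans N6.
rewrite mulrCA mulrA -/D.
by rewrite (exprS N 5); apply: ler_wpM2r; [rewrite exprn_ge0// ltW|lra].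
Qed.

End borel_cantelli.

Section rarely_large.
Context d (Omega : measurableType d) (R : realType) (P : probability Omega R).
Variables (X : R -> {RV P >-> R}) (V : R -> R) (a b gamma C : R).
Hypothesis Hind : independent_increments 1 X.
Hypothesis HG : gaussian_increments X V.
Hypothesis Vmono : {in `[0, 1] &, {homo V : s t / s < t}}.
Hypothesis Vcont : {within [set` `[0, 1]], continuous V}.
Hypothesis a0 : 0 <= a.
Hypothesis ab : a < b.
Hypothesis b1 : b <= 1.
Hypothesis gamma0 : 0 < gamma.
Hypothesis C0 : 0 < C.
Hypothesis Hlow : forall s t, a <= s -> s < t -> t <= b ->
  ((t - s) / C) `^ (gamma^-1) <= V t - V s.

(** Half of the dimension bound: the exponent of decay of the Fourier
    transform. *)
Definition decay_exponent : R := gamma / (2 + gamma).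

(** The points of mesh [1/N] that cover [[- 2 N, 2 N]] for [i] below
    [8 N^2]; the shift makes the index a natural number. *)
Definition freq (N i : nat) : R := i%:R / N%:R - 4 * N%:R.

Definition bad_freq (N i j : nat) : set Omega :=
  if (N%:R / 2 <= `|freq N i|) || (N%:R / 2 <= `|freq N j|) then
    persistently_large X a b (freq N i) (freq N j) (N%:R `^ (- decay_exponent))
  else set0.

(** The union over all pairs of indices below [8 N^2], coded by quotient and
    remainder. *)
Definition bad_scale (N : nat) : set Omega :=
  \big[setU/set0]_(l < (8 * N ^ 2) * (8 * N ^ 2))
    bad_freq N (l %/ (8 * N ^ 2)) (l %% (8 * N ^ 2)).

Lemma measurable_bad_freq N i j : measurable (bad_freq N i j).
Proof. by rewrite /bad_freq; case: ifP => // _; exact: measurable_persistently_large. Qed.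

Lemma measurable_bad_scale N : measurable (bad_scale N).
Proof. by apply: bigsetU_measurable => l _; exact: measurable_bad_freq. Qed.

Lemma bad_freqP N i j w : (i < 8 * N ^ 2)%N -> (j < 8 * N ^ 2)%N ->
  bad_freq N i j w -> bad_scale N w.
Proof.
move=> iM jM h; rewrite /bad_scale -(bigcup_mkord _ (fun l =>
  bad_freq N (l %/ (8 * N ^ 2)) (l %% (8 * N ^ 2)))).
set M := (8 * N ^ 2)%N in iM jM *.
exists (i * M + j)%N => /=.
  by apply: (@leq_trans (i * M + M)%N); rewrite ?ltn_add2l// -mulSnr leq_mul2r iM orbT.
by rewrite divnMDl ?modnMDl ?(divn_small jM) ?(modn_small jM) ?addn0//; case: (M) jM.
Qed.

(** There are [64 N^4] pairs, and each has probability at most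
    [C exp(- c N^eps)] with
    [eps = gamma/(1 + gamma) - gamma/(2 + gamma) > 0]. The shift [k0]
    makes [N] large enough for the constant factors. *)
Lemma bad_scale_le : exists k0 : nat, forall k,
  (P (bad_scale (2 ^ (k + k0))) <= ((1 / 2) ^+ k.+1)%:E)%E.
Proof.
have [a0' ab' b1' g0' C0'] := And5 a0 ab b1 gamma0 C0.
have g1 := holder_exponent_le1 ab gamma0 C0 Hlow.
pose beta := sum_exponent gamma.
have beta0 : 0 < beta by rewrite /beta /sum_exponent divr_gt0//; lra.
pose K0 := decay_constant a b gamma C.
have ba : 0 < b - a by rewrite subr_gt0.
have K00 : 0 < K0.
  have c1 := @cos1_gt0 R.
  have k1 : 0 < 2 / (cos 1 * (b - a)) by rewrite divr_gt0// mulr_gt0.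
  have k2 : 0 < (b - a)^-1 by rewrite invr_gt0.
  have k3 : 0 <= ((decay_rate R)^-1 + 1) * C `^ gamma^-1.
    by rewrite mulr_ge0 ?powR_ge0// addr_ge0// invr_ge0 ltW// decay_rate_gt0.
  by rewrite /K0 /decay_constant; lra.
pose eps := beta / 2 - decay_exponent.
have eps0 : 0 < eps.
  rewrite /eps /beta /sum_exponent /decay_exponent.
  rewrite (_ : _ - _ = gamma / ((1 + gamma) * (2 + gamma))); last first.
    by field; apply/andP; split; rewrite gt_eqF//; lra.
  by rewrite divr_gt0// mulr_gt0; lra.
pose c := (2 `^ (- (beta / 2))) / (4 * Num.sqrt K0).
have c0 : 0 < c by rewrite divr_gt0 ?powR_gt0// mulr_gt0// sqrtr_gt0.
have [N0 hN0] := expR_beats_poly (mulr_gt0 (ltr0n R 256) (expR_gt0 (1 / 2))) c0 eps0.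
(* For [N > B] the exponential bound applies, the normalized constant
   [K0 (N/2)^(- beta)] is at most 1, and [N / 2 >= 1]. *)
pose B := `|N0| + 2 * K0 `^ beta^-1 + 2.
have B0 : 0 <= B by rewrite !addr_ge0// mulr_ge0// powR_ge0.
pose A := Num.Def.archi_bound B.
exists A.+1 => k; set N := (2 ^ (k + A.+1))%N.
have BN : B < N%:R.
  apply: lt_le_trans (archi_boundP B0) _; rewrite ler_nat.
  apply: leq_trans (ltnW (ltn_expl _ (isT : 1 < 2)%N)) _.
  by rewrite leq_pexp2l// addnS; apply: leqW; exact: leq_addl.
have pw := powR_ge0 K0 beta^-1.
have NR2 : 2 <= N%:R :> R by move: BN (normr_ge0 N0); rewrite /B; lra.
have NR0 : 0 < N%:R :> R by lra.
have N0N : N0 <= N%:R by move: BN (ler_norm N0); rewrite /B; lra.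
have r1 : 1 <= N%:R / 2 :> R by lra.
have K1 : K0 * (N%:R / 2) `^ (- beta) <= 1.
  have N2p : 0 < N%:R / 2 :> R by lra.
  rewrite powRN ler_pdivrMr ?powR_gt0// mul1r.
  have -> : K0 = (K0 `^ beta^-1) `^ beta.
    by rewrite -powRrM mulVf ?lt0r_neq0// powRr1// ltW.
  apply: ge0_ler_powR; rewrite ?nnegrE; [exact: ltW|exact: pw|lra|].
  by move: BN (normr_ge0 N0); rewrite /B; lra.
have hfreq i j : (P (bad_freq N i j) <=
    (4 * (expR (1 / 2) * expR (- (c * N%:R `^ eps))))%:E)%E.
  rewrite /bad_freq; case: ifPn => [hij|_]; last first.
    by rewrite measure0 lee_fin !mulr_ge0// expR_ge0.
  have := persistently_large_tail Hind HG Vmono Vcont a0 ab b1 gamma0 C0 Hlow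
    (N%:R `^ (- decay_exponent)) r1 (orP hij) K1.
  move/le_trans; apply; rewrite lee_fin -expRD; apply: ler_wpM2l => //.
  rewrite ler_expR lerD2l lerN2 le_eqVlt; apply/orP; left; apply/eqP.
  have N2 : (0 : R) <= N%:R / 2 by lra.
  have -> : Num.sqrt (K0 * (N%:R / 2) `^ (- beta)) =
      Num.sqrt K0 * (N%:R `^ (- (beta / 2)) * 2 `^ (beta / 2)).
    rewrite sqrtrM ?(ltW K00)//; congr (_ * _).
    rewrite -(powR12_sqrt (powR_ge0 _ _)) -powRrM mulNr.
    rewrite powRM ?(ltW NR0)// ?invr_ge0//; congr (_ * _).
    by rewrite -powR_inv1// -powRrM mulrNN mul1r.
  rewrite /c (_ : N%:R `^ eps = N%:R `^ (- decay_exponent) * N%:R `^ (beta / 2));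
    last first.
    rewrite -powRD; last by rewrite (gt_eqF NR0) implybT.
    by congr (_ `^ _); rewrite /eps addrC.
  rewrite !powRN; field.
  by rewrite !gt_eqF ?powR_gt0 ?sqrtr_gt0//.
rewrite /bad_scale.
apply: (le_trans (@Boole_inequality _ _ _ P
  (fun l => bad_freq N (l %/ (8 * N ^ 2)) (l %% (8 * N ^ 2))) _ _)).
  by move=> l _; exact: measurable_bad_freq.
apply: (@le_trans _ _ (\sum_(l < (8 * N ^ 2) * (8 * N ^ 2))
   (4 * (expR (1 / 2) * expR (- (c * N%:R `^ eps))))%:E)%E).
  by apply: lee_sum => l _; exact: hfreq.
rewrite sumEFin lee_fin sumr_const card_ord.
have hN := hN0 _ N0N.
(* The exponential is compared with [N^5] rather than [N^4]: the spare factor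
   [1/N = 2^(- k)] makes the probabilities summable over the scales. *)
have e1 : (4 * (expR (1 / 2) * expR (- (c * N%:R `^ eps)))) *+ (8 * N ^ 2 * (8 * N ^ 2))
  = (256%:R * expR (1 / 2) * N%:R ^+ 5 * expR (- (c * N%:R `^ eps))) / N%:R.
  have key (M u v : R) : M != 0 ->
      4 * (u * v) * (8 * M ^+ 2 * (8 * M ^+ 2)) = 256 * u * M ^+ 5 * v / M.
    by move=> M0; field.
  by rewrite -mulr_natr !natrM natrX key// gt_eqF.
rewrite e1; apply: (@le_trans _ _ (N%:R^-1)).
  by rewrite ler_pdivrMr// mulVf ?gt_eqF.
rewrite div1r exprVn lef_pV2 ?posrE ?exprn_gt0//.
rewrite -natrX ler_nat leq_pexp2l// addnS ltnS leq_addr//.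
Qed.

Lemma ae_rarely_large : {ae P, forall w, exists k1 : nat, forall k, (k1 <= k)%N ->
  ~ bad_scale (2 ^ k) w}.
Proof.
have [k0 hk0] := bad_scale_le.
pose F k := bad_scale (2 ^ (k + k0)).
have mF k : measurable (F k) by exact: measurable_bad_scale.
have sF : (\sum_(k <oo) P (F k) < +oo)%E.
  apply: (@le_lt_trans _ _ (\sum_(k <oo) (1 / (2 ^ k.+1)%:R)%:E)%E).
    apply: lee_nneseries => [k _ _|k _]; first exact: measure_ge0.
    by apply: (le_trans (hk0 k)); rewrite lee_fin expr_div_n expr1n natrX.
  by apply: (le_lt_trans (epsilon_trick0 xpredT ler01)); rewrite ltry.
have := lim_sup_set_cvg0 mF sF => h0.
exists (lim_sup_set F); split => //.
  by apply: bigcap_measurable => [|n _]; [exists 0%N|apply: bigcup_measurable => k _].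
move=> w /= hw n _ /=.
apply: contrapT => hn; apply: hw; exists (n + k0)%N => k nk bk; apply: hn.
exists (k - k0)%N => /=; first by rewrite leq_subRL ?(leq_trans (leq_addl n k0))// addnC.
by rewrite /F subnK// (leq_trans (leq_addl n k0)).
Qed.

End rarely_large.

(** * Riemann sums *)

Section riemann_sums.
Context (R : realType).
Notation mu := (@lebesgue_measure R).

(** Near a point [x], both values are within [eps/2] of [g x]; compactness in
    its near-covering form makes the radius uniform. *)
Lemma unif_continuous_segment (g : R -> R) (a b eps : R) : continuous g ->
  0 < eps -> exists2 dl, 0 < dl & forall t, t \in `[a, b] -> forall s,
    `|s - t| <= dl -> `|g s - g t| <= eps.
Proof.
move=> cg e0.
have /compact_near_coveringP cK := @segment_compact R a b.
pose Q (dl t : R) := forall s, `|s - t| <= dl -> `|g s - g t| <= eps.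
have H : forall x, [set` `[a, b]] x ->
    \forall x' \near x & i \near 0^'+, Q i x'.
  move=> x _.
  have e2 : 0 < eps / 2 by rewrite divr_gt0.
  have /cvgrPdist_le/(_ _ e2) := cg x.
  move=> /nbhs_ballP[eta /= eta0 heta].
  exists (ball x (eta / 2), [set dl : R | dl < eta / 2]) => /=.
    split; first by apply: nbhsx_ballx; rewrite divr_gt0.
    by apply: nbhs_right_lt; rewrite divr_gt0.
  move=> [t dl] /= [xt dle] s st.
  have h1 : `|g x - g t| <= eps / 2.
    by apply: heta; apply: le_ball xt; lra.
  have h2 : `|g x - g s| <= eps / 2.
    apply: heta; rewrite /ball/=; move: xt; rewrite /ball/= => xt.
    rewrite (_ : x - s = (x - t) - (s - t)); last by ring.
    by apply: (le_lt_trans (ler_normB _ _)); lra.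
  rewrite (_ : g s - g t = (g x - g t) - (g x - g s)); last by ring.
  by apply: (le_trans (ler_normB _ _)); lra.
have := cK _ _ _ _ H => hn.
have [dl /= dl0 hd] : \forall dl \near 0^'+, forall t, [set` `[a, b]] t
  -> Q dl t by exact: hn.
exists (dl / 2); first by rewrite divr_gt0.
move=> t tab s st; apply: (hd (dl / 2)) => //=.
- by rewrite sub0r normrN gtr0_norm ?divr_gt0//; move: dl0 => /= dl0; lra.
- by rewrite divr_gt0.
Qed.

Lemma continuous_integrable_itv (g : R -> R) (a b : R) (x y : bool) : continuous g ->
  mu.-integrable [set` Interval (BSide x a) (BSide y b)] (EFin \o g).
Proof.
move=> cg; apply: (@integrableS _ _ _ mu `[a, b]) => //.
  by move=> t /=; case: x; case: y; rewrite !in_itv/= => /andP[ta tb];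
    rewrite ?ta ?tb ?(ltW ta) ?(ltW tb).
apply: continuous_compact_integrable; first exact: segment_compact.
exact: continuous_subspaceT.
Qed.

Lemma riemann_cell (g : R -> R) (s t eps : R) : continuous g -> s <= t ->
  (forall u, s < u -> u <= t -> `|g u - g s| <= eps) ->
  `|\int[mu]_(u in `]s, t]) g u - (t - s) * g s| <= (t - s) * eps.
Proof.
move=> cg st he.
have ig := @continuous_integrable_itv g s t false false cg.
have ic (c : R) : mu.-integrable `]s, t] (EFin \o cst c).
  by apply: (@continuous_integrable_itv (cst c) s t false false) => x; exact: cvg_cst.
have ms : fine (mu `]s, t]) = t - s.
  rewrite lebesgue_measure_itv/= lte_fin; case: ltP => //= h.
  by apply/esym/eqP; rewrite subr_eq0 eq_le h st.
have -> : (t - s) * g s = \int[mu]_(u in `]s, t]) (g s).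
  by rewrite Rintegral_cst// ms mulrC.
rewrite -RintegralB//; last exact: ic.
have -> : (t - s) * eps = \int[mu]_(u in `]s, t]) eps.
  by rewrite Rintegral_cst// ms mulrC.
have cgB : continuous (fun u => g u - g s).
  by move=> u; apply: cvgB; [exact: cg|exact: cvg_cst].
have igB := @continuous_integrable_itv (fun u => g u - g s) s t false false cgB.
apply: (le_trans (le_normr_Rintegral _ igB)) => //.
apply: le_Rintegral => //.
  apply: (@continuous_integrable_itv (fun u => `|g u - g s|) s t false false) => u.
  by apply: cvg_norm; exact: cgB.
  exact: ic.
by move=> u /=; rewrite in_itv/= => /andP[su ut]; exact: he.
Qed.

Lemma riemann_sum_cvg (g : R -> R) (a b : R) : continuous g -> a < b ->
  (fun n => (b - a) / n%:R * \sum_(0 <= i < n) g (a + i%:R * ((b - a) / n%:R)))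
    @ \oo --> \int[mu]_(t in `[a, b]) g t.
Proof.
move=> cg ab; apply/cvgrPdist_le => e e0.
have ba : 0 < b - a by rewrite subr_gt0.
have ea : 0 < e / (b - a) by rewrite divr_gt0.
have [dl dl0 hd] := unif_continuous_segment a b cg ea.
pose A := (b - a) / dl.
have A0 : 0 <= A by rewrite divr_ge0 ?ltW.
exists (Num.Def.archi_bound A) => // n /= hn.
have hA : A < n%:R by apply: lt_le_trans (archi_boundP A0) _; rewrite ler_nat.
have n0 : 0 < n%:R :> R by apply: le_lt_trans hA.
set h := (b - a) / n%:R.
have h0 : 0 < h by rewrite divr_gt0.
have hdl : h <= dl by rewrite /h ler_pdivrMr// mulrC -ler_pdivrMr// ltW.
pose t i : R := a + i%:R * h.
have tn : t n = b by rewrite /t /h; field; rewrite gt_eqF.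
have tS i : t i.+1 = t i + h by rewrite /t -natr1; ring.
have key j : (j <= n)%N ->
    `|\int[mu]_(u in `[a, t j]) g u - h * \sum_(0 <= i < j) g (t i)|
      <= j%:R * h * (e / (b - a)).
  elim: j => [_|j IH jn].
    rewrite big_nil mulr0 subr0 /t mul0r addr0 mul0r.
    by rewrite set_itv1 Rintegral_set1 normr0.
  have atj : a <= t j by rewrite /t lerDl mulr_ge0// ltW.
  have tjb : t j <= b by rewrite -tn /t lerD2l; apply: ler_wpM2r;
    [exact: ltW|rewrite ler_nat ltnW].
  have tjS : t j <= t j.+1 by rewrite tS lerDl ltW.
  have := @Rintegral_itvB _ g (BLeft a) (BRight (t j.+1)) (t j)
    (@continuous_integrable_itv g a (t j.+1) true false cg).
  rewrite !bnd_simp => /(_ atj tjS)/eqP; rewrite subr_eq => /eqP ->.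
  rewrite big_nat_recr//= mulrDr.
  have hc : `|\int[mu]_(u in `]t j, t j.+1]) g u - (t j.+1 - t j) * g (t j)| <=
      (t j.+1 - t j) * (e / (b - a)).
    apply: riemann_cell => // u tu ut; apply: hd; first by rewrite in_itv/= atj.
    by rewrite gtr0_norm ?subr_gt0//; move: ut; rewrite tS; lra.
  have etS : t j.+1 - t j = h by rewrite tS; ring.
  rewrite etS in hc.
  have {}IH := IH (ltnW jn).
  set I1 := \int[mu]_(u in `]t j, t j.+1]) g u in hc *.
  set I2 := \int[mu]_(u in _) g u in IH *; set S := \sum_(_ <= _ < _) _ in IH *.
  rewrite (_ : I1 + I2 - (h * S + h * g (t j)) = (I2 - h * S) + (I1 - h * g (t j)));
    last by ring.
  apply: (le_trans (ler_normD _ _)).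
  rewrite -natr1 (_ : (j%:R + 1) * h * (e / (b - a)) = j%:R * h * (e / (b - a))
    + h * (e / (b - a))); last by ring.
  exact: lerD.
have := key n (leqnn n); rewrite tn => /le_trans; apply.
by rewrite le_eqVlt; apply/orP; left; apply/eqP; rewrite /h; field; rewrite !gt_eqF.
Qed.

(** Smallness is known only for infinitely many terms. *)
Lemma frequently_limit (u : nat -> R) (l B : R) : u @ \oo --> l ->
  (forall m, exists2 n, (m <= n)%N & `|u n| <= B) -> `|l| <= B.
Proof.
move=> ul hB; rewrite leNgt; apply/negP => Bl.
have e0 : 0 < `|l| - B by rewrite subr_gt0.
have /cvgrPdist_lt/(_ _ e0)[m _ hm] := ul.
have [n mn un] := hB m; have := hm n mn => /= h.
have := ler_distD (u n) l 0; rewrite !subr0 => h2; lra.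
Qed.

Lemma cos_lipschitz (x y : R) : `|cos x - cos y| <= `|x - y|.
Proof.
wlog xy : x y / x <= y.
  by move=> H; have [/H//|/ltW/H] := leP x y; rewrite distrC (distrC y).
have [|c _] := @MVT_segment R cos (fun z => - sin z) x y xy.
  by apply: continuous_subspaceT => z; exact: continuous_cos.
rewrite distrC (distrC x) => ->; rewrite normrM normrN ler_piMl// sin_max//.
Qed.

Lemma sin_lipschitz (x y : R) : `|sin x - sin y| <= `|x - y|.
Proof.
rewrite -(cosBpihalf x) -(cosBpihalf y); apply: (le_trans (cos_lipschitz _ _)).
by rewrite (_ : x - pi / 2 - (y - pi / 2) = x - y)//; ring.
Qed.

End riemann_sums.

(** * The Fourier transform of the graph measure *)

Section frequency_grid.
Context (R : realType).

Lemma freq_approx (N : nat) (x : R) : (0 < N)%N -> `|x| <= 2 * N%:R ->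
  exists2 i, (i < 8 * N ^ 2)%N & `|x - freq R N i| <= N%:R^-1.
Proof.
move=> N0; rewrite ler_norml => /andP[xl xu].
have NR : 0 < N%:R :> R by rewrite ltr0n.
pose z := (x + 4 * N%:R) * N%:R.
have z0 : 0 <= z by rewrite mulr_ge0//; lra.
have zt : (Num.truncn z)%:R <= z by rewrite truncn_le.
have tz : z < (Num.truncn z).+1%:R by exact: truncnS_gt.
exists (Num.truncn z).
  rewrite -(ltr_nat R); apply: (le_lt_trans zt).
  rewrite natrM natrX /z; nra.
have e : x - freq R N (Num.truncn z) = (z - (Num.truncn z)%:R) / N%:R.
  by rewrite /freq /z; field; rewrite gt_eqF.
rewrite e ger0_norm; last by rewrite divr_ge0 ?subr_ge0// ltW.
rewrite ler_pdivrMr// mulVf ?gt_eqF//.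
by rewrite -natr1 in tz; lra.
Qed.

End frequency_grid.

Section path_bound.
Context (R : realType).
Notation mu := (@lebesgue_measure R).
Variables (F : R -> R) (a b L : R).
Hypothesis cF : continuous F.
Hypothesis a0 : 0 <= a.
Hypothesis ab : a < b.
Hypothesis b1 : b <= 1.
Hypothesis hL : forall t, t \in `[a, b] -> `|F t - F a| <= L.

Lemma rel_sum_lipschitz (x y x' y' e : R) n (trig : R -> R) : (0 < n)%N ->
  (forall u v, `|trig u - trig v| <= `|u - v|) ->
  `|x - x'| <= e -> `|y - y'| <= e ->
  `|\sum_(0 <= i < n) trig (x * (i%:R * ((b - a) / n%:R)) +
       y * (F (a + i%:R * ((b - a) / n%:R)) - F a)) -
    \sum_(0 <= i < n) trig (x' * (i%:R * ((b - a) / n%:R)) +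
       y' * (F (a + i%:R * ((b - a) / n%:R)) - F a))|
  <= (1 + L) * e * n%:R.
Proof.
move=> n0 lip xe ye; rewrite -sumrB.
have [a0' ab' b1'] := And3 a0 ab b1.
have nR : 0 < n%:R :> R by rewrite ltr0n.
have h0 : 0 < (b - a) / n%:R by rewrite divr_gt0// subr_gt0.
apply: (le_trans (ler_norm_sum _ _ _)).
apply: (@le_trans _ _ (\sum_(0 <= i < n) (1 + L) * e)); last first.
  by rewrite sumr_const_nat subn0 mulr_natr.
apply: ler_sum_nat => i /andP[_ ilt].
apply: (le_trans (lip _ _)).
set u := i%:R * _; set v := F _ - F a.
have u0 : 0 <= u by rewrite mulr_ge0// ltW.
have ub : u <= b - a.
  rewrite /u -[leRHS](divfK (lt0r_neq0 nR)) [leRHS]mulrC.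
  by apply: ler_wpM2r; [exact: ltW|rewrite ler_nat ltnW].
have u1 : `|u| <= 1 by rewrite ger0_norm//; lra.
have vL : `|v| <= L by apply: hL; rewrite in_itv/=; apply/andP; split; lra.
clearbody v u.
rewrite (_ : _ - _ = (x - x') * u + (y - y') * v); last by ring.
apply: (le_trans (ler_normD _ _)); rewrite !normrM mulrDl mul1r.
have e0 : 0 <= e by apply: le_trans xe.
apply: lerD; last by rewrite mulrC; apply: ler_pM.
by rewrite -[leRHS]mulr1; apply: ler_pM => //; rewrite ?mul1r.
Qed.

(** Move from [(x', y')] to [(x, y)] in the discrete sums, then let [n] tend
    to infinity along the sums that are small. *)
Lemma path_integral_bound (x y x' y' e s : R) : 0 <= s ->
  `|x - x'| <= e -> `|y - y'| <= e ->
  (forall m, exists2 n, (m <= n)%N &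
     `|rel_cos a ((b - a) / n%:R) F x' y' n| <= s * n%:R /\
     `|rel_sin a ((b - a) / n%:R) F x' y' n| <= s * n%:R) ->
  `|\int[mu]_(t in `[a, b]) cos (x * t + y * F t)| <= 2 * (b - a) * (s + (1 + L) * e) /\
  `|\int[mu]_(t in `[a, b]) sin (x * t + y * F t)| <= 2 * (b - a) * (s + (1 + L) * e).
Proof.
move=> s0 xe ye H.
have ba : 0 < b - a by rewrite subr_gt0.
have cth : continuous (fun t => x * t + y * F t).
  move=> t; apply: cvgD; first exact: mulrl_continuous.
  apply: cvgM; [exact: cvg_cst|exact: cF].
have ccos : continuous (fun t => cos (x * t + y * F t)).
  by move=> t; apply: continuous_comp; [exact: cth|exact: continuous_cos].
have csin : continuous (fun t => sin (x * t + y * F t)).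
  by move=> t; apply: continuous_comp; [exact: cth|exact: continuous_sin].
pose phi := x * a + y * F a.
have eph h i : x * (a + i%:R * h) + y * F (a + i%:R * h) =
    phi + (x * (i%:R * h) + y * (F (a + i%:R * h) - F a)) by rewrite /phi; ring.
have H' m : exists2 n, (m <= n)%N & (0 < n)%N /\
   (`|rel_cos a ((b - a) / n%:R) F x y n| <= (s + (1 + L) * e) * n%:R /\
     `|rel_sin a ((b - a) / n%:R) F x y n| <= (s + (1 + L) * e) * n%:R).
  have [n mn [hc hs]] := H (maxn m 1); exists n; first by apply: leq_trans mn;
    exact: leq_maxl.
  have n0 : (0 < n)%N by apply: leq_trans mn; exact: leq_maxr.
  split => //.
  have h1 := rel_sum_lipschitz n0 (@cos_lipschitz R) xe ye.
  have h2 := rel_sum_lipschitz n0 (@sin_lipschitz R) xe ye.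
  rewrite (mulrDl s _ n%:R); split.
    rewrite -[X in `|X|](subrKC (rel_cos a ((b - a) / n%:R) F x' y' n)).
    by apply: (le_trans (ler_normD _ _)); exact: (lerD hc h1).
  rewrite -[X in `|X|](subrKC (rel_sin a ((b - a) / n%:R) F x' y' n)).
  by apply: (le_trans (ler_normD _ _)); exact: (lerD hs h2).
have fin n (u v : R) : (0 < n)%N -> `|u| <= (s + (1 + L) * e) * n%:R ->
    `|v| <= (s + (1 + L) * e) * n%:R ->
    forall c d : R, `|c| <= 1 -> `|d| <= 1 ->
    `|(b - a) / n%:R * (c * u + d * v)| <= 2 * (b - a) * (s + (1 + L) * e).
  move=> n0 hu hv c d c1 d1.
  have nR : 0 < n%:R :> R by rewrite ltr0n.
  rewrite normrM (ger0_norm (ltW (divr_gt0 ba nR))).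
  have h : `|c * u + d * v| <= 2 * ((s + (1 + L) * e) * n%:R).
    apply: (le_trans (ler_normD _ _)); rewrite !normrM mulr2n mulrDl mul1r.
    by apply: lerD; rewrite -[leRHS]mul1r; apply: ler_pM.
  apply: (le_trans (ler_wpM2l (ltW (divr_gt0 ba nR)) h)).
  by rewrite le_eqVlt; apply/orP; left; apply/eqP; field; rewrite gt_eqF.
split.
  apply: (frequently_limit (riemann_sum_cvg ccos ab)) => m.
  have [n mn [n0 [hc hs]]] := H' m; exists n => //.
  rewrite (_ : \sum_(0 <= i < n) _ =
      cos phi * rel_cos a ((b - a) / n%:R) F x y n +
      (- sin phi) * rel_sin a ((b - a) / n%:R) F x y n).
    by apply: fin => //; rewrite ?normrN ?cos_max ?sin_max.
  rewrite /rel_cos /rel_sin !mulr_sumr -big_split/=; apply: eq_bigr => i _.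
  by rewrite eph cosD mulNr.
apply: (frequently_limit (riemann_sum_cvg csin ab)) => m.
have [n mn [n0 [hc hs]]] := H' m; exists n => //.
rewrite (_ : \sum_(0 <= i < n) _ =
    sin phi * rel_cos a ((b - a) / n%:R) F x y n +
    cos phi * rel_sin a ((b - a) / n%:R) F x y n).
  by apply: fin => //; rewrite ?cos_max ?sin_max.
rewrite /rel_cos /rel_sin !mulr_sumr -big_split/=; apply: eq_bigr => i _.
by rewrite eph sinD.
Qed.

End path_bound.

Section graph_measure.
Context (R : realType).
Notation mu := (@lebesgue_measure R).

(** The measure is the image of Lebesgue measure on [[a, b]] under
    [t |-> (t, F t)]. The function [F] extends the path [f] continuously to
    the whole line, which makes this map measurable. *)
Lemma graph_decay (f F : R -> R) (a b alpha D : R) : continuous F -> a < b ->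
  (forall t, t \in `[a, b] -> F t = f t) ->
  (forall xi : R * R, xi != 0 ->
    `|\int[mu]_(t in `[a, b]) cos (- (2 * pi * xi.1) * t + - (2 * pi * xi.2) * F t)|
      <= D * euclidean_norm xi `^ (- (alpha / 2)) /\
    `|\int[mu]_(t in `[a, b]) sin (- (2 * pi * xi.1) * t + - (2 * pi * xi.2) * F t)|
      <= D * euclidean_norm xi `^ (- (alpha / 2))) ->
  fourier_decay_on (graph_on f [set` `[a, b]]) alpha.
Proof.
move=> cF ab Ff hD.
have mF : measurable_fun setT F by exact: continuous_measurable_fun.
have mph : measurable_fun [set: R] (fun t => (t, F t)).
  by apply: measurable_fun_pair.
pose ph : {mfun (measurableTypeR R) >-> (R * R)%type} :=
  HB.pack (fun t : measurableTypeR R => (t, F t))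
    (isMeasurableFun.Build _ _ (measurableTypeR R) (R * R)%type _ mph).
have mI : measurable [set` `[a, b]] by exact: measurable_itv.
have Ifin : (mu [set` `[a, b]] < +oo)%E.
  by rewrite lebesgue_measure_itv/= lte_fin ab -EFinB ltry.
pose muI := @mfrestr _ (measurableTypeR R) R [set` `[a, b]] mu mI Ifin.
pose nu := fpushforward muI ph.
have nuint (g : R * R -> R) : (forall z, `|g z| <= 1) -> measurable_fun setT g ->
    \int[nu]_z g z = \int[mu]_(t in `[a, b]) g (t, F t).
  move=> cg mg; congr fine.
  have mgph : measurable_fun setT (g \o ph).
    by apply: (measurableT_comp mg); exact: mph.
  have ig : muI.-integrable setT (EFin \o (g \o ph)).
    apply: measurable_bounded_integrable => //.
      rewrite -[X in (X < _)%E]/(mu (setT `&` [set` `[a, b]])) setTI.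
      exact: Ifin.
    exists 1; split; first by rewrite realE ler01.
    by move=> z z1 t _ /=; apply: (le_trans (cg _)); exact: ltW.
  transitivity (\int[muI]_t (EFin \o (g \o ph)) t)%E.
    by rewrite (@integral_pushforward _ _ _ _ _ ph)//; exact/measurable_EFinP.
  rewrite (@negligible_integral _ _ _ muI setT (~` [set` `[a, b]]))//.
  - rewrite setTD setCK; apply: eq_measure_integral => A mA AI.
    by rewrite -[LHS]/(mu (A `&` [set` `[a, b]])) setIidl.
  - exact: measurableC.
  - by rewrite -[LHS]/(mu (~` [set` `[a, b]] `&` [set` `[a, b]])) setICl measure0.
exists nu; split.
- rewrite -[X in X != _]/(mu ((ph @^-1` setT) `&` [set` `[a, b]])) preimage_setT setTI.
  by rewrite lebesgue_measure_itv/= lte_fin ab -EFinB eqe subr_eq0 gt_eqF.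
- pose Gr : set (R * R) := [set z | z.1 \in `[a, b] /\ z.2 - F z.1 = 0].
  have mGr : measurable Gr.
    rewrite (_ : Gr = (setT `&` fst @^-1` [set` `[a, b]]) `&`
        (setT `&` (fun z : R * R => z.2 - F z.1) @^-1` [set 0])); last first.
      by apply/seteqP; split => z /=; [move=> [? ?]|move=> [[_ ?] [_ ?]]].
    apply: measurableI.
      by apply: measurable_fst => //; exact: measurable_itv.
    have m2 : measurable_fun [set: R * R] (fun z : R * R => z.2 - F z.1).
      by apply: measurable_funB => //; exact: (measurableT_comp mF measurable_fst).
    by apply: m2 => //; exact: measurable_set1.
  exists (~` Gr); split; first exact: measurableC.
    rewrite -[LHS]/(mu ((ph @^-1` (~` Gr)) `&` [set` `[a, b]])).
    rewrite (_ : _ `&` _ = set0) ?measure0//; apply/seteqP; split => // t [/= h tab].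
    by apply: h; rewrite /Gr /= subrr.
  move=> z /= hz [zab z2]; apply: hz; exists z.1 => //.
  by rewrite -Ff//; case: z zab z2 => z1 z2 /= _ /eqP; rewrite subr_eq0 => /eqP ->.
exists (2 * D) => xi xi0; have [hc hs] := hD xi xi0.
have mdot : measurable_fun setT (fun z : R * R => - (2 * pi * dot xi z)).
  apply: measurableT_comp => //; apply: measurable_funM => //.
  by apply: measurable_funD; apply: measurable_funM.
have edot t : - (2 * pi * dot xi (t, F t)) = - (2 * pi * xi.1) * t +
  - (2 * pi * xi.2) * F t.
  by rewrite /dot/=; ring.
have ec : \int[nu]_z cos (- (2 * pi * dot xi z)) =
    \int[mu]_(t in `[a, b]) cos (- (2 * pi * xi.1) * t + - (2 * pi * xi.2) * F t).
  rewrite nuint; first by apply: eq_Rintegral => t _; rewrite edot.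
    by move=> z; exact: cos_max.
  by apply: (measurableT_comp _ mdot); apply: continuous_measurable_fun;
    exact: continuous_cos.
have es : \int[nu]_z sin (- (2 * pi * dot xi z)) =
    \int[mu]_(t in `[a, b]) sin (- (2 * pi * xi.1) * t + - (2 * pi * xi.2) * F t).
  rewrite nuint; first by apply: eq_Rintegral => t _; rewrite edot.
    by move=> z; exact: sin_max.
  by apply: (measurableT_comp _ mdot); apply: continuous_measurable_fun;
    exact: continuous_sin.
rewrite -[fourier_transform nu xi]/(Complex (\int[nu]_z cos (- (2 * pi * dot xi z)))
   (\int[nu]_z sin (- (2 * pi * dot xi z)))) ec es.
set u := \int[mu]_(t in _) cos _ in hc *; set v := \int[mu]_(t in _) sin _ in hs *.
apply: (@le_trans _ _ (`|u| + `|v|)); last by rewrite -mulrA mulr2n mulrDl mul1r;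
  exact: lerD.
rewrite /Normc.normc; apply: ler_of_sqr; first by rewrite addr_ge0.
rewrite sqr_sqrtr ?addr_ge0 ?sqr_ge0// sqrrD !real_normK ?num_real//.
by rewrite lerD2r lerDl mulrn_wge0// mulr_ge0.
Qed.
End graph_measure.

Section path_decay.
Context d (Omega : measurableType d) (R : realType) (P : probability Omega R).
Notation mu := (@lebesgue_measure R).

Lemma clamp_continuous (f : R -> R) (a b : R) : a <= b ->
  {within [set` `[a, b]], continuous f} ->
  continuous (fun t => f (Num.max a (Num.min b t))).
Proof.
move=> ab /subspace_continuousP cf t.
pose c (t : R) := Num.max a (Num.min b t).
have cI u : [set` `[a, b]] (c u).
  by rewrite /= in_itv/= /c le_max lexx/= ge_max ab ge_min lexx.
have cc : continuous c.
  move=> u; apply: (@continuous_max _ _ (fun=> a) (fun u => Num.min b u)).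
    exact: cvg_cst.
  apply: (@continuous_min _ _ (fun=> b) idfun); [exact: cvg_cst|exact: cvg_id].
apply: (@cvg_trans _ (f @ within [set` `[a, b]] (nbhs (c t)))); last exact: cf.
move=> U hU; have h : nbhs t (c @^-1` [set v | [set` `[a, b]] v -> U (f v)]).
  exact: (cc t _ hU).
rewrite /nbhs/=; move: h; apply: filterS => u hu; exact: (hu (cI u)).
Qed.

Lemma trig_integral_le (g : R -> R) (a b : R) : a < b -> continuous g ->
  (forall t, `|g t| <= 1) -> `|\int[mu]_(t in `[a, b]) g t| <= b - a.
Proof.
move=> ab cg g1.
have ig := @continuous_integrable_itv R g a b true false cg.
have i1 := @continuous_integrable_itv R (cst 1) a b true false (fun x => cvg_cst _).
apply: (le_trans (le_normr_Rintegral _ ig)) => //.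
have -> : b - a = \int[mu]_(t in `[a, b]) 1.
  have ms : fine (mu `[a, b]) = b - a by rewrite lebesgue_measure_itv/= lte_fin ab.
  by rewrite Rintegral_cst// ms mul1r.
apply: le_Rintegral => //; last exact: i1.
apply: (@continuous_integrable_itv R (fun u => `|g u|) a b true false) => u.
by apply: cvg_norm; exact: cg.
Qed.

Lemma dyadic_scale (r : R) (k1 : nat) : 2 ^+ k1 <= r ->
  exists2 k, (k1 <= k)%N & 2 ^+ k <= r <= 2 * 2 ^+ k.
Proof.
move=> hr; have r1 : 1 <= r by apply: le_trans hr; rewrite exprn_ege1//; lra.
have r0 : 0 <= r by lra.
pose n := Num.truncn r.
have hn : n%:R <= r by rewrite truncn_le.
have hn1 : r < n.+1%:R by exact: truncnS_gt.
have k1n : (2 ^ k1 <= n)%N.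
  by rewrite -ltnS -(ltr_nat R) natrX; exact: le_lt_trans hn1.
have n0 : (0 < n)%N by apply: leq_trans k1n; rewrite expn_gt0.
have /andP[h1 h2] := trunc_log_bounds (isT : 1 < 2)%N n0.
exists (trunc_log 2 n).
  rewrite -ltnS -(ltn_exp2l _ _ (isT : 1 < 2)%N); exact: leq_ltn_trans h2.
apply/andP; split; first by apply: le_trans hn; rewrite -natrX ler_nat.
rewrite -exprS; apply: (le_trans (ltW hn1)); rewrite -natrX ler_nat.
exact: h2.
Qed.

Lemma euclidean_norm_le (xi : R * R) :
  euclidean_norm xi <= Num.max `|- (2 * pi * xi.1)| `|- (2 * pi * xi.2)|.
Proof.
have pi2 := pi_ge2 R.
have n2 : `|2 * pi| = 2 * pi :> R by rewrite ger0_norm// mulr_ge0// pi_ge0.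
rewrite /euclidean_norm /dot !normrN !(normrM (2 * pi)) n2.
set p := `|xi.1|; set q := `|xi.2|.
have p0 : 0 <= p by exact: normr_ge0.
have q0 : 0 <= q by exact: normr_ge0.
set M := Num.max _ _.
have hp : 2 * pi * p <= M by rewrite le_max lexx.
have hq : 2 * pi * q <= M by rewrite le_max lexx orbT.
have M0 : 0 <= M by apply: le_trans hp; rewrite !mulr_ge0//; lra.
apply: ler_of_sqr => //; rewrite sqr_sqrtr; last by rewrite addr_ge0// -expr2 sqr_ge0.
rewrite -!expr2 -(real_normK (num_real xi.1)) -(real_normK (num_real xi.2)) -/p -/q.
have hp' : 2 * p <= M by nra.
have hq' : 2 * q <= M by nra.
nra.
Qed.

Lemma euclidean_norm_gt0 (xi : R * R) : xi != 0 -> 0 < euclidean_norm xi.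
Proof.
move=> xi0; rewrite /euclidean_norm sqrtr_gt0 /dot -!expr2 lt_neqAle addr_ge0 ?sqr_ge0//
  andbT.
apply: contra xi0; rewrite eq_sym paddr_eq0 ?sqr_ge0// !sqrf_eq0 => /andP[/eqP h1 /eqP h2].
by apply/eqP; case: xi h1 h2 => x y /= -> ->.
Qed.

Variables (X : R -> {RV P >-> R}) (a b gamma : R).
Hypothesis a0 : 0 <= a.
Hypothesis ab : a < b.
Hypothesis b1 : b <= 1.
Hypothesis gamma0 : 0 < gamma.

(** A frequency of size [r >= 2^(k1 + 1)] is compared with a grid point at the
    scale [N = 2^k] with [N <= r <= 2 N]. Smaller frequencies are covered by
    the constant [M1^dl]. *)
Lemma path_decay w k1 : {within [set` `[0, 1]], continuous (X ^~ w)} ->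
  (forall k, (k1 <= k)%N -> ~ bad_scale X a b gamma (2 ^ k) w) ->
  fourier_decay_on (graph_on (X ^~ w) [set` `[a, b]]) (2 * gamma / (2 + gamma)).
Proof.
have [a0' ab' b1' g0'] := And4 a0 ab b1 gamma0.
move=> cX hbad.
pose f t := X t w; pose F t := f (Num.max a (Num.min b t)).
have sub : [set` `[a, b]] `<=` [set` `[0, 1]].
  by move=> x /=; rewrite !in_itv/= => /andP[? ?]; apply/andP; split; lra.
have cf := continuous_subspaceW sub cX.
have cF : continuous F by exact: (clamp_continuous (ltW ab) cf).
have Ff t : t \in `[a, b] -> F t = f t.
  by rewrite in_itv/= => /andP[h1 h2]; rewrite /F min_r// max_r.
have cL : {within [set` `[a, b]], continuous (fun t => `|F t - F a|)}.
  apply: continuous_subspaceT => t; apply: cvg_norm; apply: cvgB;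
    [exact: cF|exact: cvg_cst].
have [c _ hc] := EVT_max (ltW ab) cL.
set L := `|F c - F a| in hc.
have L0 : 0 <= L by exact: normr_ge0.
set dl := decay_exponent gamma.
have dl0 : 0 < dl by rewrite /dl /decay_exponent divr_gt0//; lra.
have dl1 : dl <= 1 by rewrite /dl /decay_exponent ler_pdivrMr ?mul1r; lra.
have -> : 2 * gamma / (2 + gamma) = 2 * dl by rewrite /dl /decay_exponent mulrA.
pose M1 : R := 2 ^+ k1.+1.
have M10 : 0 < M1 by rewrite exprn_gt0.
pose D := 4 * (2 + L) + M1 `^ dl.
apply: (@graph_decay _ f F a b (2 * dl) D cF ab Ff) => xi xi0.
have -> : 2 * dl / 2 = dl by field.
set x := - (2 * pi * xi.1); set y := - (2 * pi * xi.2).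
pose r := Num.max `|x| `|y|.
have e0 := euclidean_norm_gt0 xi0.
have er : euclidean_norm xi <= r by exact: euclidean_norm_le.
have r0 : 0 < r by exact: lt_le_trans er.
have epow (t : R) : euclidean_norm xi <= t -> t `^ (- dl) <= euclidean_norm xi `^ (- dl).
  move=> et; have t0 : 0 < t by exact: lt_le_trans et.
  rewrite !powRN lef_pV2 ?posrE ?powR_gt0//.
  by apply: ge0_ler_powR; rewrite ?nnegrE// ltW.
set E := euclidean_norm xi `^ (- dl).
have E0 : 0 <= E by exact: powR_ge0.
have cth : continuous (fun t => x * t + y * F t).
  move=> t; apply: cvgD; first exact: mulrl_continuous.
  apply: cvgM; [exact: cvg_cst|exact: cF].
have [rM|Mr] := ltP r M1.
  have hE : 1 <= M1 `^ dl * E.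
    have := epow M1 (le_trans er (ltW rM)); rewrite -/E => h.
    apply: le_trans (ler_wpM2l (powR_ge0 _ _) h).
    by rewrite powRN divff// gt_eqF// powR_gt0.
  have D1 : 1 <= D * E.
    by rewrite /D mulrDl; apply: (le_trans hE); rewrite lerDr !mulr_ge0// addr_ge0.
  have ba1 : b - a <= 1 by lra.
  split; apply: le_trans D1; apply: le_trans ba1; apply: trig_integral_le => //.
  - by move=> t; apply: continuous_comp; [exact: cth|exact: continuous_cos].
  - by move=> t; exact: cos_max.
  - by move=> t; apply: continuous_comp; [exact: cth|exact: continuous_sin].
  - by move=> t; exact: sin_max.
have [k k1k /andP[kr rk]] := dyadic_scale Mr.
pose N := (2 ^ k)%N.
have NE : N%:R = 2 ^+ k :> R by rewrite natrX.
have N0 : (0 < N)%N by rewrite expn_gt0.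
have NR : 0 < N%:R :> R by rewrite ltr0n.
have N2 : 2 <= N%:R :> R.
  by rewrite ler_nat -[leqLHS]expn1 leq_pexp2l//; exact: leq_ltn_trans k1k.
have [xr yr] : `|x| <= r /\ `|y| <= r by rewrite /r !le_max !lexx orbT.
have [i iM xi'] := @freq_approx R N x N0 ltac:(by rewrite NE; exact: le_trans rk).
have [j jM yj'] := @freq_approx R N y N0 ltac:(by rewrite NE; exact: le_trans rk).
have invN : N%:R^-1 <= 1 / 2 :> R by rewrite div1r lef_pV2 ?posrE.
have big : (N%:R / 2 <= `|freq R N i|) || (N%:R / 2 <= `|freq R N j|).
  have : N%:R <= `|x| \/ N%:R <= `|y|.
    by apply/orP; rewrite -le_max NE.
  move=> [h|h]; apply/orP; [left|right].
    have := ler_distD (freq R N i) x 0; rewrite !subr0 => h2; lra.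
  have := ler_distD (freq R N j) y 0; rewrite !subr0 => h2; lra.
set s := N%:R `^ (- dl).
have s0 : 0 <= s by exact: powR_ge0.
have Hfreq m : exists2 n, (m <= n)%N &
     `|rel_cos a ((b - a) / n%:R) F (freq R N i) (freq R N j) n| <= s * n%:R /\
     `|rel_sin a ((b - a) / n%:R) F (freq R N i) (freq R N j) n| <= s * n%:R.
  have nb := hbad k (ltnW k1k).
  have : ~ persistently_large X a b (freq R N i) (freq R N j) s w.
    move=> hp; apply: nb; apply: (@bad_freqP _ _ _ _ _ _ _ _ _ i j) => //.
    by rewrite /bad_freq big.
  (* The maximum with 1 excludes the degenerate grid with [n = 0]. *)
  move=> np; apply: contrapT => hn; apply: np; exists (maxn m 1) => // n /= mn.
  have mn' : (m <= n)%N by apply: leq_trans mn; exact: leq_maxl.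
  have n0 : (0 < n)%N by apply: leq_trans mn; exact: leq_maxr.
  have gI l : (l <= n)%N -> F (a + l%:R * ((b - a) / n%:R))
    = f (a + l%:R * ((b - a) / n%:R)).
    by move=> ln; apply: Ff; rewrite in_itv/=; exact: (grid_le ab n0 ln).
  have Fa : F a = f a by apply: Ff; rewrite in_itv/= lexx ltW.
  have eC : rel_cos a ((b - a) / n%:R) F (freq R N i) (freq R N j) n =
            rel_cos a ((b - a) / n%:R) f (freq R N i) (freq R N j) n.
    by apply: eq_big_nat => l /andP[_ ln]; rewrite Fa gI// ltnW.
  have eS : rel_sin a ((b - a) / n%:R) F (freq R N i) (freq R N j) n =
            rel_sin a ((b - a) / n%:R) f (freq R N i) (freq R N j) n.
    by apply: eq_big_nat => l /andP[_ ln]; rewrite Fa gI// ltnW.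
  rewrite /large_sum /=.
  have [h1|h1] := leP (s * n%:R) `|rel_cos a ((b - a) / n%:R) (X^~ w) (freq R N i)
    (freq R N j) n|; first by left.
  have [h2|h2] := leP (s * n%:R) `|rel_sin a ((b - a) / n%:R) (X^~ w) (freq R N i)
    (freq R N j) n|; first by right.
  by exfalso; apply: hn; exists n => //; rewrite eC eS; split; exact: ltW.
have key := path_integral_bound cF a0 ab b1 hc s0 xi' yj' Hfreq.
have hB : 2 * (b - a) * (s + (1 + L) * N%:R^-1) <= D * E.
  have h1 : N%:R^-1 <= s.
    by rewrite -(powR_inv1 (ltW NR)); apply: ler_powR; [lra|rewrite lerN2].
  have h2 : s <= 2 * E.
    have hE : (2 * N%:R) `^ (- dl) <= E by apply: epow; apply: (le_trans er); rewrite NE.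
    rewrite (powRM _ (ler0n R 2) (ltW NR)) in hE.
    have h22 : 2^-1 <= (2 : R) `^ (- dl).
      by rewrite -(powR_inv1 (ler0n R 2)); apply: ler_powR; [lra|rewrite lerN2].
    move: hE; rewrite -/s; nra.
  have ba1 : 2 * (b - a) <= 2 by lra.
  have h3 : s + (1 + L) * N%:R^-1 <= (2 + L) * s by nra.
  have h4 : 0 <= s + (1 + L) * N%:R^-1 by rewrite addr_ge0// mulr_ge0 ?invr_ge0 ?ltW//; lra.
  apply: (@le_trans _ _ (2 * ((2 + L) * s))); first by apply: ler_pM => //; lra.
  apply: (@le_trans _ _ (2 * ((2 + L) * (2 * E)))).
    by apply: ler_wpM2l => //; apply: ler_wpM2l => //; lra.
  rewrite (_ : 2 * ((2 + L) * (2 * E)) = 4 * (2 + L) * E); last by ring.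
  rewrite /D (mulrDl (4 * (2 + L))).
  by rewrite lerDl mulr_ge0// powR_ge0.
by case: key => [k2 k3]; split; [exact: le_trans hB|exact: le_trans hB].
Qed.

End path_decay.

(** * The theorem *)

Section assembly.
Context d (Omega : measurableType d) (R : realType) (P : probability Omega R).

Lemma probability_ae_eq (A B : set Omega) : measurable A -> measurable B ->
  {ae P, forall w, A w <-> B w} -> P A = P B.
Proof.
move=> mA mB [N [mN PN0 hN]].
have half (U V : set Omega) : measurable U -> measurable V ->
    (forall w, ~ N w -> U w -> V w) -> (P U <= P V)%E.
  move=> mU mV h; apply: (@le_trans _ _ (P (V `|` N))).
    apply: le_measure; rewrite ?inE//; first exact: measurableU.
    by move=> w Uw; have [Nw|nN] := pselect (N w); [right|left; exact: h].
  by apply: (le_trans (measureU2 P mV mN)); rewrite [X in (_ + X)%E]PN0 adde0.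
have eqv w : ~ N w -> (A w <-> B w).
  by move=> nN; apply: contrapT => h; apply: nN; exact: hN.
apply/eqP; rewrite eq_le !half// => w /eqv[h1 h2]; [exact: h2|exact: h1].
Qed.

(** [X_t - X_s] agrees almost surely with the increment of [B] between [V s]
    and [V t]. *)
Lemma representation_gaussian (X B : R -> {RV P >-> R}) (V : R -> R) :
  brownian_representation X B V ->
  {in `[0, 1] &, {homo V : s t / s < t}} -> gaussian_increments X V.
Proof.
move=> [[V0 Vle Vc] _ [_ _ HN _] HXB] HV s t s0 st t1 A mA.
have s01 : s \in `[0, 1] by rewrite in_itv/=; apply/andP; split; lra.
have t01 : t \in `[0, 1] by rewrite in_itv/=; apply/andP; split; lra.
have z01 : 0 \in `[0, 1 : R] by rewrite in_itv/=; apply/andP; split; lra.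
have o01 : 1 \in `[0, 1 : R] by rewrite in_itv/=; apply/andP; split; lra.
have Vr u : u \in `[0, 1] -> V u \in `[0, V 1].
  move=> u01; have := u01; rewrite in_itv/= => /andP[u0 u1].
  by rewrite in_itv/= -{1}V0 !Vle.
rewrite -HN ?Vr//; last exact: HV.
have mf (Y : {mfun Omega >-> R}) : measurable (Y @^-1` A).
  by rewrite -[_ @^-1` _]setTI; exact: measurable_funP.
apply: probability_ae_eq; [exact: mf|exact: (mf (B (V t) \- B (V s)))|].
have h1 := HXB s s01; have h2 := HXB t t01.
by apply: filterS2 h1 h2 => w /= e1 e2; rewrite e1 e2.
Qed.

End assembly.

Theorem theorem5p1 (d : measure_display) (Omega : measurableType d)
    (R : realType) (P : probability Omega R)
    (X B : R -> {RV P >-> R}) (V T : R -> R) (a b gamma : R)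
    (HX : centered_continuous_additive_process X)
    (HB : brownian_representation X B V)
    (HV : {in `[0, 1] &, {homo V : s t / s < t}})
    (HT : {in `[0, 1], cancel V T})
    (Ha : 0 <= a) (Hab : a < b) (Hb : b <= 1)
    (Hgamma : 0 < gamma)
    (Hholder : exists2 C : R, 0 < C &
       forall x y, (V @` [set` `[a, b]]) x -> (V @` [set` `[a, b]]) y ->
         `|T x - T y| <= C * `|x - y| `^ gamma) :
  {ae P, forall w,
    ((2 * gamma / (2 + gamma))%:E
       <= fourier_dim (graph_on (fun t => X t w) [set` `[a, b]]))%E}.
Proof.
have HG := representation_gaussian HB HV.
have [[Hind _ _] Hpath _] := HX.
have [[_ _ Vcont] _ _ _] := HB.
have [C C0 hC] := Hholder.
have Hlow s t : a <= s -> s < t -> t <= b -> ((t - s) / C) `^ gamma^-1 <= V t - V s.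
  move=> as_ st tb.
  have s01 : s \in `[0, 1] by rewrite in_itv/=; apply/andP; split; lra.
  have t01 : t \in `[0, 1] by rewrite in_itv/=; apply/andP; split; lra.
  have Vst : 0 < V t - V s by rewrite subr_gt0; exact: HV.
  have := hC (V t) (V s).
  have sI : (V @` [set` `[a, b]]) (V s) by exists s => //=; rewrite in_itv/=;
    apply/andP; split; lra.
  have tI : (V @` [set` `[a, b]]) (V t) by exists t => //=; rewrite in_itv/=;
    apply/andP; split; lra.
  move=> /(_ tI sI); rewrite !HT// (gtr0_norm Vst) gtr0_norm ?subr_gt0// => h.
  have h' : (t - s) / C <= (V t - V s) `^ gamma by rewrite ler_pdivrMr// mulrC.
  rewrite -[leRHS](powRr1 (ltW Vst)) -(divff (lt0r_neq0 Hgamma)) powRrM.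
  apply: ge0_ler_powR => //; rewrite ?nnegrE ?powR_ge0 ?invr_ge0 ?divr_ge0 ?subr_ge0//;
    exact: ltW.
have Hrare := ae_rarely_large Hind HG HV Vcont Ha Hab Hb Hgamma C0 Hlow.
apply: filterS2 Hpath Hrare => w cw [k1 hk1].
apply: ereal_sup_ubound => /=; exists (2 * gamma / (2 + gamma)) => //; split.
  by rewrite divr_ge0//; lra.
exact: (path_decay Ha Hab Hb Hgamma cw hk1).
Qed.
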